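(* Let $k$ be a field and let $G$ be a chordal bipartite graph with bipartition $V = \{x_1,\ldots,x_n\} \cup \{y_1,\ldots,y_m\}$. Let $r = |\{x_i \mid \deg x_i = 1\}|$ and $s = |\{y_j \mid \deg y_j = 1\}|$. Then the toric ideal $I_G$ satisfies \[\operatorname{reg}(I_G) \leq \min\{n-r,m-s\}.\]
   Context: Graphs are finite and simple. A graph is chordal bipartite if it is bipartite and has no induced subgraph that is a cycle of length six or larger. For a graph $G=(V,E)$, let $k[V]$ and $k[E]$ be polynomial rings over the field $k$ whose variables are the vertices, respectively the edges, of $G$. The toric ideal $I_G\subseteq k[E]$ is the kernel of the $k$-algebra map $\pi:k[E]\to k[V]$ sending each edge $e=\{u,v\}$ to $uv$. It is homogeneous for the standard grading of $k[E]$. Writing $\beta_{i,j}(I_G)$ for the number of copies of $k[E](-j)$ in homological degree $i$ of the graded minimal free resolution of $I_G$ as a $k[E]$-module (homological degree $0$ corresponds to minimal generators), the Castelnuovo-Mumford regularity is $\operatorname{reg}(I_G)=\max\{j-i \mid \beta_{i,j}(I_G)\neq 0\}$. *)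

(* Defs.v *)
From HB Require Import structures.
From mathcomp Require Import all_boot all_order all_algebra.
From mathcomp Require Import mpoly.

Set Implicit Arguments.
Unset Strict Implicit.
Unset Printing Implicit Defensive.

Import Order.TTheory GRing.Theory Num.Theory.

Local Open Scope ring_scope.

(* A finite simple graph is a symmetric irreflexive relation [e] on a finType. *)
Section Graphs.

Variables (V : finType) (e : rel V).

Definition degree (u : V) : nat := #|[set v | e u v]|.

Definition edges : {set {set V}} :=
  [set A : {set V} | [exists u, exists v, e u v && (A == [set u; v])]].

Definition bipartition (X Y : {set V}) : Prop :=
  [/\ X :|: Y = [set: V], X :&: Y = set0 &
      forall u v, e u v ->
        (u \in X) && (v \in Y) || (u \in Y) && (v \in X)].

Definition bipartite : Prop := exists X Y : {set V}, bipartition X Y.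

(* [ordS] is the cyclic successor on 'I_l, so for 3 <= l the relation on the
   right-hand side is adjacency in the cycle of length l. *)
Definition induced_cycle (l : nat) (c : 'I_l -> V) : Prop :=
  injective c /\
  forall i j, e (c i) (c j) = (ordS i == j) || (ordS j == i).

Definition chordal_bipartite : Prop :=
  bipartite /\
  forall (l : nat) (c : 'I_l -> V), (6 <= l)%N -> ~ induced_cycle c.

Variable k : fieldType.

(* k[E] is {mpoly k[#|edges|]} and k[V] is {mpoly k[#|V|]}: variable i of k[E]
   is the edge [enum_val i], and vertex v is variable [enum_rank v] of k[V]. *)
Definition edge_monomial (A : {set V}) : {mpoly k[#|V|]} :=
  \prod_(v in A) 'X_(enum_rank v).

Definition toric_map (p : {mpoly k[#|edges|]}) : {mpoly k[#|V|]} :=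
  p \mPo [tuple edge_monomial (enum_val i) | i < #|edges|].

Definition toric_ideal : pred {mpoly k[#|edges|]} :=
  fun p => toric_map p == 0.

End Graphs.

Arguments toric_map {V} e k p.
Arguments toric_ideal {V} e k p.

Section Resolutions.

Variables (N : nat) (k : fieldType).
Local Notation S := {mpoly k[N]}.

Definition homogz (d : int) (p : S) : Prop :=
  match d with
  | Posz d' => p \is d'.-homog
  | Negz _ => p = 0
  end.

(* The data of ... -> F_2 -> F_1 -> F_0 -> S, where F_i is the direct sum of
   the S(-j), j = [fshift i a], a < [frank i]. Elements of F_i are row vectors
   and maps act by multiplication on the right. *)
Record free_complex := FreeComplex {
  frank : nat -> nat;
  fshift : forall i, 'I_(frank i) -> int;
  fdiff : forall i, 'M[S]_(frank i.+1, frank i);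
  faug : 'cV[S]_(frank 0) }.

Variable F : free_complex.

(* The basis vector a of F_i has degree [fshift F i a], so these conditions say
   that the maps are homogeneous of degree 0. *)
Definition graded_complex : Prop :=
  (forall a, homogz (fshift a) (faug F a ord0)) /\
  (forall i a b, homogz (fshift a - fshift b) (fdiff F i a b)).

(* Exactness of ... -> F_1 -> F_0 -> I -> 0. *)
Definition resolves (I : pred S) : Prop :=
  [/\ forall p, I p <-> exists v : 'rV[S]_(frank F 0), v *m faug F = p%:M,
      forall v : 'rV[S]_(frank F 0),
        v *m faug F = 0 <-> exists w, v = w *m fdiff F 0 &
      forall i (v : 'rV[S]_(frank F i.+1)),
        v *m fdiff F i = 0 <-> exists w, v = w *m fdiff F i.+1].

(* im(F_{i+1} -> F_i) lies in mF_i, where m is the ideal of the variables: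
   the entries of the matrices have zero constant coefficient. *)
Definition minimal_complex : Prop :=
  forall i a b, (fdiff F i a b)@_0%MM = 0.

Definition graded_minimal_free_resolution (I : pred S) : Prop :=
  [/\ graded_complex, resolves I & minimal_complex].

Definition betti (i : nat) (j : int) : nat :=
  #|[set a : 'I_(frank F i) | fshift a == j]|.

(* [is_regularity rho] says rho = max {j - i | betti i j <> 0}; the value [None]
   stands for minus infinity, the maximum of the empty set (zero ideal). *)
Definition is_regularity (rho : option int) : Prop :=
  match rho with
  | None => forall i j, betti i j = 0%N
  | Some r =>
      (exists (i : nat) (j : int), betti i j <> 0%N /\ r = j - i%:Z) /\
      (forall (i : nat) (j : int), betti i j <> 0%N -> j - i%:Z <= r)
  end.

End Resolutions.

Definition ext_le (rho : option int) (b : int) : Prop :=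
  match rho with
  | None => True
  | Some r => r <= b
  end.

(* Main.v *)
(** A basis element of degree j in step i of the minimal free resolution of I_G
    produces, by a zigzag, a nonzero Koszul homology class of k[E]/I_G in
    homological degree i + 1 and internal degree j, so it suffices to show that
    this homology vanishes when j - i exceeds the bound.

    Order the vertices by a doubly lexical ordering; for a chordal bipartite
    graph it is Gamma-free: x < x', y < y' and xy, xy', x'y in E imply x'y' in E.
    Call edges xy' and x'y with x < x', y < y' crossing when xy is in E; then
    xy' * x'y - xy * x'y' lies in I_G.  With respect to a weight that makes
    xy' * x'y the leading term, every vertex degree has at most one monomial
    without crossings, so the products of crossing edges generate the initial
    ideal.  Filtering Koszul cycles by weight reduces the vanishing to this
    squarefree monomial ideal, that is, to complexes of sets of pairwise
    noncrossing edges.  Deletion and link at the last edge of a row x kill, in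
    the link, all crossings with upper row x, so homology vanishes above the
    number of upper rows.  Both rows of a crossing have degree at least 2, and the
    lower row met by the last upper row is not upper, so there are fewer than n - r
    upper rows as soon as there is one. *)

Require Import Defs.
From HB Require Import structures.
From mathcomp Require Import all_boot all_order all_algebra all_fingroup.
From mathcomp Require Import mpoly.
From mathcomp Require Import zify ring.
From Stdlib Require Import ClassicalEpsilon.

Set Implicit Arguments.
Unset Strict Implicit.
Unset Printing Implicit Defensive.

Import Order.TTheory GRing.Theory Num.Theory.

Local Open Scope ring_scope.

(** * The Koszul differential and its combinatorial part *)

Section KoszulDifferential.

Variables (N : nat) (R : comNzRingType).
Implicit Types (c : 'I_N -> R) (f g : {set 'I_N} -> R) (i j : 'I_N)
  (A M U s t : {set 'I_N}).

Definition ksign i t : R := (-1) ^+ #|[set u in t | u < i]%N|.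

(** A chain is its coefficient function on subsets. With the variables for [c] this is the Koszul
    differential; with 0/1 values it is one of its multigraded pieces. *)
Definition kdiff c f t : R := \sum_(i | i \notin t) ksign i t * c i * f (i |: t).

Lemma ksign_sqr i t : ksign i t * ksign i t = 1.
Proof. by rewrite /ksign -expr2 sqrr_sign. Qed.

Lemma ksignU1 i j t : j \notin t ->
  ksign i (j |: t) = (-1) ^+ (j < i)%N * ksign i t.
Proof.
move=> jt; rewrite /ksign -exprD; congr (_ ^+ _).
case: ltnP => ji.
  have -> : [set u in j |: t | (u < i)%N] = j |: [set u in t | (u < i)%N].
    by apply/setP=> u; rewrite !inE; case: eqP => // ->.
  by rewrite cardsU1 inE (negbTE jt).
rewrite add0n; apply: eq_card => u; rewrite !inE.
by case: eqP => //= ->; rewrite ltnNge ji /= andbF.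
Qed.

(** Inserting the other index changes exactly one of the two signs, that of the larger index. *)
Lemma ksign_anticomm i j t : i != j -> i \notin t -> j \notin t ->
  ksign i (j |: t) * ksign j t = - (ksign j (i |: t) * ksign i t).
Proof.
move=> ij it jt; rewrite !ksignU1 //.
have [ltij|ltji|/val_inj eij] := ltngtP i j; last by rewrite eij eqxx in ij.
- by rewrite /= expr0 expr1; ring.
- by rewrite /= expr0 expr1; ring.
Qed.

Lemma eq_kdiff c f g t : (forall i, i \notin t -> f (i |: t) = g (i |: t)) ->
  kdiff c f t = kdiff c g t.
Proof. by move=> fg; apply: eq_bigr => i it; rewrite fg. Qed.

Lemma kdiff0 c t : kdiff c (fun=> 0) t = 0.
Proof. by rewrite /kdiff big1 // => i _; rewrite mulr0. Qed.

Lemma kdiffB c f g t : kdiff c (fun s => f s - g s) t = kdiff c f t - kdiff c g t.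
Proof. by rewrite /kdiff -sumrB; apply: eq_bigr => i _; rewrite mulrBr. Qed.

Lemma kdiffD c f g t : kdiff c (fun s => f s + g s) t = kdiff c f t + kdiff c g t.
Proof. by rewrite /kdiff -big_split; apply: eq_bigr => i _; rewrite mulrDr. Qed.

Lemma kdiff_kdiff c f t : kdiff c (kdiff c f) t = 0.
Proof.
pose F i j := ksign i t * c i * (ksign j (i |: t) * c j * f (j |: (i |: t))).
have -> : kdiff c (kdiff c f) t =
    \sum_(i | i \notin t) \sum_(j | (j \notin t) && (j != i)) F i j.
  apply: eq_bigr => i _; rewrite /kdiff mulr_sumr; apply: eq_bigl => j.
  by rewrite !inE negb_or andbC.
have FN i j : i \notin t -> j \notin t -> i != j -> F i j = - F j i.
  move=> it jt ij; rewrite /F setUCA.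
  have := ksign_anticomm ij it jt; move: (f _) => z H.
  transitivity ((ksign j (i |: t) * ksign i t) * (c i * c j * z)); first by ring.
  by rewrite -[X in X * _]opprK -H; ring.
have split_lt i : i \notin t -> \sum_(j | (j \notin t) && (j != i)) F i j =
    \sum_(j | (j \notin t) && (j < i)%N) F i j +
    \sum_(j | (j \notin t) && (i < j)%N) F i j.
  move=> it; rewrite (bigID (fun j => (j < i)%N)) /=.
  by congr (_ + _); apply: eq_bigl => j; rewrite -andbA; congr (_ && _);
     rewrite -val_eqE /=; case: ltngtP.
rewrite (eq_bigr _ split_lt) big_split /=.
apply/eqP; rewrite addrC addr_eq0 -sumrN; apply/eqP.
rewrite (exchange_big_dep (fun j => j \notin t)) /=; last by move=> i j _ /andP[].
apply: eq_bigr => j jt; rewrite -sumrN.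
apply: eq_big => [i|i /andP[it]]; first by rewrite jt.
by move=> /andP[_ ij]; apply: FN => //; rewrite -val_eqE /= neq_ltn ij.
Qed.

End KoszulDifferential.

(** * Cohomology of independence complexes *)

Section IndependenceHomology.

Variables (N : nat) (k : comNzRingType).
Implicit Types (f g : {set 'I_N} -> k) (v : 'I_N) (A M U s t : {set 'I_N}).

(** On complements [U :\: t] this is the simplicial coboundary: the value at a face is a signed sum
    over its facets. *)
Definition sdiff U := kdiff (fun i : 'I_N => (i \in U)%:R : k).

(** Contracting homotopy of a cone with apex [v]. If [v] is not in [t], only the term inserting [v]
    survives; otherwise the cocycle condition at [t :\ v] rewrites [f t]. *)
Lemma sdiff_cone U v f t : v \in U -> (v \in t -> sdiff U f (t :\ v) = 0) ->
  sdiff U (fun s => if v \in s then ksign k v (s :\ v) * f (s :\ v) else 0) t = f t.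
Proof.
move=> vU; rewrite /sdiff /kdiff; case: (boolP (v \in t)) => vt H.
  have {H} := H isT; rewrite (bigD1 v) ?setD11 //= vU mulr1 setD1K // => H.
  set S := (X in _ + X = 0) in H.
  have fE : f t = - ksign k v (t :\ v) * S.
    have -> : S = - (ksign k v (t :\ v) * f t).
      by apply/eqP; rewrite -addr_eq0 addrC H.
    by rewrite mulrNN mulrA ksign_sqr mul1r.
  rewrite fE mulr_sumr; apply: eq_big => [i|i it].
    by rewrite !inE; case: eqP => [->|_] /=; rewrite ?vt ?andbT.
  have vi : v != i by apply: contraNneq it => <-.
  rewrite !inE vt orbT.
  have -> : (i |: t) :\ v = i |: (t :\ v).
    by apply/setP=> u; rewrite !inE; case: (u =P i) => // ->; rewrite eq_sym vi.
  have itv : i \notin t :\ v by rewrite !inE negb_and it orbT.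
  have := @ksign_anticomm N k i v (t :\ v); rewrite eq_sym vi itv !inE eqxx /= setD1K //.
  move=> /(_ isT isT isT) A.
  rewrite [LHS](_ : _ = ksign k i t * ksign k v (i |: t :\ v) * ((i \in U)%:R * f (i |: t :\ v)));
    last by ring.
  have B := ksign_sqr k v (t :\ v).
  have -> : ksign k i t = - (ksign k v (i |: t :\ v) * ksign k i (t :\ v)) * ksign k v (t :\ v).
    by rewrite -A -mulrA B mulr1.
  have C := ksign_sqr k v (i |: t :\ v).
  set x := ksign k v (i |: t :\ v) in C *; set y := ksign k i _; set z := ksign k v _.
  rewrite [LHS](_ : _ = - (x * x) * y * z * ((i \in U)%:R * f (i |: t :\ v))); last by ring.
  by rewrite C; ring.
rewrite (bigD1 v) //= vU setU11 setU1K // mulr1 mulrA ksign_sqr mul1r big1 ?addr0 //.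
move=> i /andP[it iv]; rewrite !inE eq_sym (negbTE iv) (negbTE vt) /=.
by rewrite mulr0.
Qed.

Lemma sdiffD1 U v f t : v \in U -> v \notin t ->
  sdiff U f t = ksign k v t * f (v |: t) + sdiff (U :\ v) f t.
Proof.
move=> vU vt; rewrite /sdiff /kdiff (bigD1 v) //= vU mulr1; congr (_ + _).
rewrite [RHS](bigD1 v) //= setD11 mulr0 mul0r add0r.
by apply: eq_bigr => i /andP[_ iv]; rewrite !inE iv.
Qed.

Variables (T : finType) (h : rel 'I_N) (row : 'I_N -> T) (pos : 'I_N -> nat).
Hypothesis h_irr : irreflexive h.
Hypothesis h_nested : forall a a' b,
  row a = row a' -> (pos a <= pos a')%N -> h a b -> h a' b.

(** Both orders of a pair are tested, so the directed relation [h] acts here as an undirected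
    graph. *)
Definition independent A := [forall a in A, forall b in A, ~~ h a b].

Lemma independentP A :
  reflect {in A &, forall a b, ~~ h a b} (independent A).
Proof.
apply: (iffP forall_inP) => [H a b aA bA|H a aA].
  by have /forall_inP := H _ aA; apply.
by apply/forall_inP => b bA; apply: H.
Qed.

(* Each deletion-link step at a vertex of maximal position in its row either
   keeps the rows or, in the link, loses one of them. *)
Lemma independent_acyclic_gen n M U (r : {set T}) c f :
  (#|U :\: M| <= n)%N ->
  {in U :\: M &, forall a b, h a b -> row a \in r} -> (#|r| <= c)%N ->
  (forall t, M \subset t -> t \subset U -> independent (U :\: t) ->
     (c.+1 < #|U :\: t|)%N -> sdiff U f t = 0) ->
  exists g, forall s, M \subset s -> s \subset U -> independent (U :\: s) ->
     (c < #|U :\: s|)%N -> f s = sdiff U g s.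
Proof.
(* The faces are [U :\: s] with [s] containing [M]: deleting a vertex enlarges [M], while a link
   shrinks [U] and puts the neighbours into [M]. *)
elim: n M U r c f => [|n IHn] M U r c f.
  rewrite leqn0 cards_eq0 setD_eq0 => UM _ _ _.
  exists (fun=> 0) => s Ms sU _; have : #|U :\: s| = 0%N.
    by apply/eqP; rewrite cards_eq0 setD_eq0 (subset_trans UM).
  by move=> ->.
move=> leUM hr rc Hf.
case: (boolP (independent (U :\: M))) => [/independentP indep|]; last first.
  case/forall_inPn => a aUM /forall_inPn[b bUM /negPn hab].
  have aP : (a \in U :\: M) && (row a == row a) by rewrite aUM eqxx.
  (* By [h_nested], [v] is related to every target of the remaining vertices of its row. *)
  pose v := [arg max_(v > a | (v \in U :\: M) && (row v == row a)) pos v].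
  have [vUM rva vmax] : [/\ v \in U :\: M, row v = row a &
      forall u, u \in U :\: M -> row u = row a -> (pos u <= pos v)%N].
    rewrite /v; case: arg_maxnP => // w /andP[wUM /eqP rw] wmax; split=> // u uUM ru.
    by apply: wmax; rewrite uUM ru eqxx.
  have hvb : h v b by apply: h_nested hab => //; apply: vmax.
  have [vM vU] : v \notin M /\ v \in U by move: vUM; rewrite inE => /andP[].
  have rr : row a \in r by apply: hr hab.
  pose Nv := [set b in U | h v b || h b v].
  have cardDv (W : {set _}) : v \in W -> W \subset U :\: M -> (#|W :\ v| <= n)%N.
    move=> vW WUM; have := subset_leq_card WUM; rewrite (cardsD1 v W) vW.
    by move/leq_trans/(_ leUM).
  (* Deletion of [v]: [f] is a coboundary on the large faces avoiding [v]. *)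
  have [g1 Hg1] : exists g, forall s, v |: M \subset s -> s \subset U ->
      independent (U :\: s) -> (c < #|U :\: s|)%N -> f s = sdiff U g s.
    apply: (IHn (v |: M) U r c f) => //.
    - have -> : U :\: (v |: M) = (U :\: M) :\ v by rewrite setUC setDDl.
      by apply: cardDv.
    - move=> x y xU yU; apply: hr; [move: xU | move: yU];
      by rewrite !inE negb_or -andbA => /and3P[_ -> ->].
    - by move=> t Mt; apply: Hf; apply: subset_trans Mt; rewrite subsetUr.
  (* Correcting by this primitive makes the cocycle vanish on the large faces avoiding [v], so it
     lives on the link. *)
  pose g1' s := if v \in s then g1 s else 0.
  pose f' s := f s - sdiff U g1' s.
  have f'0 s : M \subset s -> s \subset U -> independent (U :\: s) ->
      (c < #|U :\: s|)%N -> v \in s -> f' s = 0.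
    move=> Ms sU iU cU vs; apply/eqP; rewrite subr_eq0; apply/eqP.
    rewrite Hg1 //; last by rewrite subUset sub1set vs.
    by apply: eq_kdiff => i _; rewrite /g1' !inE vs orbT.
  have f'c t : M \subset t -> t \subset U -> independent (U :\: t) ->
     (c.+1 < #|U :\: t|)%N -> sdiff U f' t = 0.
    by move=> *; rewrite /sdiff kdiffB kdiff_kdiff subr0; apply: Hf.
  have UtD t : t \subset U :\ v -> U :\: t = v |: (U :\ v) :\: t.
    move=> tU; apply/setP=> x; rewrite !inE; case: (x =P v) => //= ->.
    by rewrite vU andbT; apply/negP => /(subsetP tU); rewrite setD11.
  have cardU t : t \subset U :\ v -> #|U :\: t| = #|(U :\ v) :\: t|.+1.
    by move=> /UtD ->; rewrite cardsU1 !inE eqxx andbF.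
  have indU t : t \subset U :\ v -> M :|: Nv \subset t ->
      independent ((U :\ v) :\: t) -> independent (U :\: t).
    move=> tU Nt /independentP I; apply/independentP => x y.
    have Nvt z : z \in (U :\ v) :\: t -> ~~ (h v z || h z v).
      rewrite !inE => /and3P[zt _ zU]; apply: contra zt => hz.
      by apply: (subsetP Nt); rewrite !inE zU hz orbT.
    rewrite UtD // => /setU1P[->|xU] /setU1P[->|yU].
    - by rewrite h_irr.
    - by have := Nvt _ yU; rewrite negb_or => /andP[].
    - by have := Nvt _ xU; rewrite negb_or => /andP[].
    - exact: I.
  case: c => [|c] in rc Hf Hg1 f'0 f'c *.
    by move: rc; rewrite leqn0 cards_eq0 => /eqP r0; rewrite r0 inE in rr.
  (* Link of [v]: the neighbours are gone, so vertices of [row a] have no target left and the row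
     leaves [r]. Faces lose [v], which matches the drop of the bound from [c.+1] to [c]. *)
  have [g2 Hg2] : exists g, forall s, M :|: Nv \subset s -> s \subset U :\ v ->
      independent ((U :\ v) :\: s) -> (c < #|(U :\ v) :\: s|)%N ->
      f' s = sdiff (U :\ v) g s.
    apply: (IHn (M :|: Nv) (U :\ v) (r :\ row a) c f') => //.
    - apply: leq_trans (cardDv (U :\: M) vUM (subxx _)).
      by apply/subset_leq_card/subsetP => x; rewrite !inE negb_or => /and3P[/andP[-> _] -> ->].
    - move=> x y; rewrite !inE !negb_or -!andbA => /and4P[xM xN xv xU] /and4P[yM yN yv yU] hxy.
      rewrite (hr _ _ _ _ hxy) ?inE ?xM ?yM // andbT.
      apply: contraNneq yN => rx; rewrite yU /=; apply/orP; left.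
      by apply: h_nested hxy; rewrite ?rva //; apply: vmax; rewrite ?inE ?xM.
    - by move: rc; rewrite (cardsD1 (row a) r) rr.
    - move=> t Mt tU it ct.
      have vt : v \notin t by apply/negP => /(subsetP tU); rewrite setD11.
      have tU' : t \subset U by apply: subset_trans tU (subD1set _ _).
      have Mt' : M \subset t by apply: subset_trans Mt; rewrite subsetUl.
      have := f'c t Mt' tU' (indU _ tU Mt it); rewrite cardU // => /(_ ct).
      have UvT : U :\: (v |: t) = (U :\ v) :\: t.
        by apply/setP=> x; rewrite !inE negb_or; case: (x =P v); rewrite ?andbF.
      rewrite (sdiffD1 f' vU vt) f'0 ?mulr0 ?add0r // ?UvT //.
      - by apply: subset_trans Mt' _; rewrite subsetUr.
      - by rewrite subUset sub1set vU.
      - by rewrite setU11.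
  (* The primitive on the link is extended by zero to the faces avoiding [v]. *)
  pose g2' s := if v \in s then 0 else g2 s.
  exists (fun s => g1' s + g2' s) => s Ms sU iU cU; rewrite /sdiff kdiffD.
  apply/eqP; rewrite addrC -subr_eq -/(sdiff U) -/(f' s); apply/eqP.
  case: (boolP (v \in s)) => vs.
    rewrite f'0 // -[LHS](kdiff0 (fun i : 'I_N => (i \in U)%:R) s).
    by apply: eq_kdiff => i _; rewrite /g2' !inE vs orbT.
  have sUv : s \subset U :\ v by rewrite subsetD1 sU.
  rewrite (sdiffD1 g2' vU vs) /g2' setU11 mulr0 add0r.
  move: iU cU; rewrite UtD // => /independentP iU cU.
  rewrite Hg2 //.
  - apply: eq_bigr => i _; case: (i =P v) => [->|/eqP iv]; first by rewrite setD11 mulr0 !mul0r.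
    have -> // : (v \in i |: s) = false by rewrite !inE eq_sym (negbTE iv) (negbTE vs).
  - rewrite subUset Ms; apply/subsetP => x; rewrite inE => /andP[xU hx].
    apply/negPn/negP => xs.
    have xv : x != v by apply: contraTneq hx => ->; rewrite h_irr.
    have xW : x \in v |: (U :\ v) :\: s by rewrite !inE xs xv xU orbT.
    by move: hx; rewrite (negbTE (iU _ _ (setU11 _ _) xW)) (negbTE (iU _ _ xW (setU11 _ _))).
  - by apply/independentP => x y xU yU; apply: iU; apply: setU1r.
  - by move: cU; rewrite -UtD // cardU.
(* No related pair is left: every subset of [U :\: M] is a face, and any vertex is the apex of a
   cone. *)
case: (set_0Vmem (U :\: M)) => [U0|[v vUM]].
  exists (fun=> 0) => s Ms sU _; have : #|U :\: s| = 0%N.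
    apply/eqP; rewrite cards_eq0 setD_eq0; apply: subset_trans Ms.
    by rewrite -setD_eq0 U0.
  by move=> ->.
have [vM vU] : v \notin M /\ v \in U by move: vUM; rewrite inE => /andP[].
exists (fun s => if v \in s then ksign k v (s :\ v) * f (s :\ v) else 0).
move=> s Ms sU iU cU; rewrite sdiff_cone // => vs; apply: Hf.
- by rewrite subsetD1 Ms.
- by apply: subset_trans sU; apply: subD1set.
- apply/independentP => x y xU yU; apply: indep; [move: xU | move: yU];
  rewrite !inE => /andP[xs ->]; rewrite andbT; apply: contra xs => xM;
  by rewrite (subsetP Ms) // andbT; apply: contraNneq vM => <-.
- have -> : U :\: (s :\ v) = v |: (U :\: s).
    by apply/setP=> x; rewrite !inE; case: (x =P v) => //= ->; rewrite vU.
  by rewrite cardsU1 !inE vs.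
Qed.

Lemma independent_acyclic U (r : {set T}) f :
  {in U &, forall a b, h a b -> row a \in r} ->
  (forall t, t \subset U -> independent (U :\: t) -> sdiff U f t = 0) ->
  exists g, forall s, s \subset U -> independent (U :\: s) ->
     (#|r| < #|U :\: s|)%N -> f s = sdiff U g s.
Proof.
move=> hr Hf.
have := @independent_acyclic_gen #|U| set0 U r #|r| f.
rewrite setD0 => /(_ (leqnn _) hr (leqnn _)) [t _ tU it _|g Hg]; first exact: Hf.
by exists g => s sU; apply: Hg; rewrite ?sub0set.
Qed.

End IndependenceHomology.

(** * Koszul cycles of a quotient of the polynomial ring *)

Section KoszulPolynomials.

Variables (N : nat) (k : fieldType).
Local Notation S := {mpoly k[N]}.
Implicit Types (z y : {set 'I_N} -> S) (m mu : 'X_{1..N}) (s t : {set 'I_N}).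

Definition kbd z := kdiff (fun i => 'X_i : S) z.

Definition msquarefree t : 'X_{1..N} := [multinom (i \in t : nat) | i < N].

Definition mnmsupp mu : {set 'I_N} := [set i | 0 < mu i]%N.

Lemma mcoeff_mulXi (i : 'I_N) (p : S) m :
  ('X_i * p)@_m = if (0 < m i)%N then p@_(m - U_(i)) else 0.
Proof.
rewrite mulrC; case: ltnP => mi.
  have le_im : (U_(i) <= m)%MM.
    by apply/mnm_lepP => j; rewrite mnm1E; case: eqP => // <-.
  by rewrite -{1}(submK le_im) addmC mcoeffMX.
apply/eqP; rewrite mcoeff_eq0 (perm_mem (msuppMX _ _)).
by apply/negP => /mapP[m' _ mE]; move: mi; rewrite mE mnmDE mnm1E eqxx.
Qed.

Lemma mcoeff_ksignM (i : 'I_N) t (p : S) m :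
  (ksign _ i t * p)@_m = ksign _ i t * p@_m.
Proof.
by rewrite /ksign -signr_odd -[in RHS]signr_odd !mulr_sign; case: odd; rewrite ?mcoeffN.
Qed.

Lemma eq_sdiff (R : comNzRingType) (U t : {set 'I_N}) (f g : {set 'I_N} -> R) :
  (forall i, i \notin t -> i \in U -> f (i |: t) = g (i |: t)) ->
  sdiff U f t = sdiff U g t.
Proof.
move=> fg; apply: eq_bigr => i it; have [iU|iU] := boolP (i \in U).
  by rewrite fg.
by rewrite mulr0 !mul0r.
Qed.

Lemma submDsquarefree (i : 'I_N) m t : i \notin t -> (0 < m i)%N ->
  (m + msquarefree t - msquarefree (i |: t))%MM = (m - U_(i))%MM.
Proof.
move=> it mi; apply/mnmP=> j; rewrite !(mnmDE, mnmBE, mnm1E, mnmE) !inE.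
by rewrite eq_sym; case: (i =P j) => [<-|_]; rewrite ?(negbTE it) ?subn0 ?addnK ?addn0.
Qed.

(** The Koszul complex splits by multidegree, with one monomial for each subset of the support.
    Where the subtraction would truncate, the coefficient in [sdiff] is zero. *)
Lemma mcoeff_kbd z t m : (kbd z t)@_m =
  sdiff (mnmsupp (m + msquarefree t))
    (fun s => (z s)@_(m + msquarefree t - msquarefree s)) t.
Proof.
rewrite raddf_sum; apply: eq_bigr => i it.
rewrite /= -mulrA mcoeff_ksignM mcoeff_mulXi -mulrA; congr (_ * _).
rewrite inE mnmDE mnmE (negbTE it) addn0.
by case: ltnP => mi; rewrite ?mul0r // mul1r submDsquarefree.
Qed.

Definition mpoly_of (d : nat) (E : 'X_{1..N} -> k) : S :=
  \sum_(m : 'X_{1..N < d}) E m *: 'X_[m].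

Lemma mcoeff_mpoly_of d E m :
  (mpoly_of d E)@_m = if (mdeg m < d)%N then E m else 0.
Proof.
case: ltnP => md; first by rewrite mcoeff_mpoly.
rewrite raddf_sum big1 //= => -[m' /= m'd] _.
rewrite mcoeffZ mcoeffX; case: eqP => [E'|]; last by rewrite mulr0.
by move: m'd; rewrite E' ltnNge md.
Qed.

Definition bihomogeneous p q z :=
  forall s m, (z s)@_m != 0 -> #|s| = p /\ mdeg m = q.

Variable w : 'I_N -> nat.

Definition mweight m : nat := (\sum_i m i * w i)%N.

Lemma mweightD m m' : mweight (m + m') = (mweight m + mweight m')%N.
Proof. by rewrite /mweight -big_split; apply: eq_bigr => i _; rewrite mnmDE mulnDl. Qed.

Variables (J : S -> Prop) (std : pred 'X_{1..N}).
Hypothesis J0 : J 0.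
Hypothesis JD : forall a b, J a -> J b -> J (a + b).
Hypothesis JM : forall a x, J x -> J (a * x).
Hypothesis J_std : forall x m, J x -> std m ->
  (forall m', x@_m' != 0 -> (mweight m' <= mweight m)%N) -> x@_m = 0.
Hypothesis J_red : forall m, ~~ std m ->
  exists m', [/\ mdeg m' = mdeg m, (mweight m' < mweight m)%N & J ('X_[m] - 'X_[m'])].

Lemma J_opp x : J x -> J (- x).
Proof. by move=> Jx; rewrite -mulN1r; apply: JM. Qed.

Lemma J_sum (I : finType) (F : I -> S) : (forall i, J (F i)) -> J (\sum_i F i).
Proof. by move=> JF; apply: (big_ind J). Qed.

Lemma J_kbd z t : (forall s, J (z s)) -> J (kbd z t).
Proof.
by move=> Jz; rewrite /kbd /kdiff; apply: (big_ind J) => // i _; apply: JM.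
Qed.

Variables (p q : nat).
Hypothesis multigraded_exact : forall mu, mdeg mu = (p + q)%N ->
  forall f : {set 'I_N} -> k,
  (forall t, t \subset mnmsupp mu -> std (mu - msquarefree t)%MM ->
     sdiff (mnmsupp mu) f t = 0) ->
  exists g, forall s, s \subset mnmsupp mu -> #|s| = p ->
     std (mu - msquarefree s)%MM -> f s = sdiff (mnmsupp mu) g s.

Lemma msquarefree_le t mu : t \subset mnmsupp mu -> (msquarefree t <= mu)%MM.
Proof.
move=> tU; apply/mnm_lepP => i; rewrite mnmE; case: (boolP (i \in t)) => // it.
by have := subsetP tU _ it; rewrite inE.
Qed.

Lemma mdeg_squarefree t : mdeg (msquarefree t) = #|t|.
Proof.
by rewrite mdegE -sum1_card [RHS]big_mkcond; apply: eq_bigr => i _; rewrite mnmE; case: ifP.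
Qed.

Lemma sub_mnmsuppD m t : t \subset mnmsupp (m + msquarefree t).
Proof. by apply/subsetP => i it; rewrite inE mnmDE mnmE it addn1. Qed.

(* The top-weight part of a cycle modulo J is, multidegree by multidegree, a
   cycle of the monomial quotient spanned by the standard monomials. *)
Lemma koszul_top_weight W z : bihomogeneous p q z ->
  (forall t, J (kbd z t)) ->
  (forall s m, (z s)@_m != 0 -> (mweight (m + msquarefree s) <= W)%N) ->
  exists y, [/\ bihomogeneous p.+1 q.-1 y, (q = 0%N -> forall s, y s = 0) &
    forall s m, (z s - kbd y s)@_m != 0 ->
      [/\ #|s| = p, mdeg m = q, (mweight (m + msquarefree s) <= W)%N &
        std m -> (mweight (m + msquarefree s) < W)%N]].
Proof.
move=> hz Jz wz.
have [G HG] : exists G : 'X_{1..N} -> {set 'I_N} -> k, forall mu,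
    mdeg mu = (p + q)%N -> mweight mu = W ->
    forall s, s \subset mnmsupp mu -> #|s| = p -> std (mu - msquarefree s)%MM ->
    (z s)@_(mu - msquarefree s) = sdiff (mnmsupp mu) (G mu) s.
  suff H mu : exists g, mdeg mu = (p + q)%N -> mweight mu = W ->
      forall s, s \subset mnmsupp mu -> #|s| = p -> std (mu - msquarefree s)%MM ->
      (z s)@_(mu - msquarefree s) = sdiff (mnmsupp mu) g s.
    exists (fun mu => sval (constructive_indefinite_description _ (H mu))) => mu.
    by case: constructive_indefinite_description.
  case: (mdeg mu =P (p + q)%N) => [dmu|]; last by exists (fun=> 0).
  case: (mweight mu =P W) => [wmu|]; last by exists (fun=> 0).
  have [|g Hg] := multigraded_exact dmu
    (f := fun s => (z s)@_(mu - msquarefree s)).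
    move=> t tU st.
    have mtE : (mu - msquarefree t + msquarefree t)%MM = mu.
      by rewrite submK // msquarefree_le.
    have := mcoeff_kbd z t (mu - msquarefree t); rewrite mtE => <-.
    (* Every monomial [m'] of [kbd z t] has [m' + msquarefree t] of weight at most [W], so the
       standard monomial considered has top weight and [J_std] applies. *)
    apply: J_std => // m'; rewrite mcoeff_kbd => nz.
    rewrite -(leq_add2r (mweight (msquarefree t))) -!mweightD mtE wmu.
    rewrite leqNgt; apply: contra nz => ltW; apply/eqP.
    rewrite -[RHS](kdiff0 (fun i : 'I_N => (i \in mnmsupp (m' + msquarefree t))%:R) t).
    apply: eq_sdiff => i it; rewrite inE mnmDE mnmE (negbTE it) addn0 => mi.
    rewrite submDsquarefree //; apply/eqP; apply: contraTT ltW => /wz.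
    rewrite -leqNgt; congr (mweight _ <= _)%N; apply/mnmP => j.
    rewrite !(mnmDE, mnmBE, mnm1E, mnmE) !inE.
    by rewrite [j == i]eq_sym; case: (i =P j) => [<-|_]; rewrite ?(negbTE it) /= ?subn0 // addn0 subnK.
  by exists g.
(* For [q = 0] the degree test never holds, so [y] vanishes and the value of [q.-1] does no harm. *)
pose y s := mpoly_of q (fun m => if [&& (mdeg m).+1 == q, #|s| == p.+1 &
  mweight (m + msquarefree s) == W] then G (m + msquarefree s)%MM s else 0).
have yE s m : (y s)@_m = if [&& (mdeg m).+1 == q, #|s| == p.+1 &
  mweight (m + msquarefree s) == W] then G (m + msquarefree s)%MM s else 0.
  by rewrite mcoeff_mpoly_of; case: ltnP => // mq; case: eqP => //; lia.
exists y; split.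
- move=> s m; rewrite yE; case: and3P => [[/eqP mq /eqP -> _] _|]; last by rewrite eqxx.
  by split=> //; rewrite -mq.
- move=> q0 s; apply/mpolyP => m; rewrite yE q0 mcoeff0.
  by case: and3P => // -[/eqP].
have kbdyE s m : (kbd y s)@_m = if [&& mdeg m == q, #|s| == p &
    mweight (m + msquarefree s) == W]
    then sdiff (mnmsupp (m + msquarefree s)) (G (m + msquarefree s)%MM) s else 0.
  rewrite mcoeff_kbd.
  have aux i : i \notin s -> i \in mnmsupp (m + msquarefree s) ->
      (y (i |: s))@_(m + msquarefree s - msquarefree (i |: s)) =
      if [&& mdeg m == q, #|s| == p & mweight (m + msquarefree s) == W]
      then G (m + msquarefree s)%MM (i |: s) else 0.
    move=> iS; rewrite inE => mi.
    have sU : i |: s \subset mnmsupp (m + msquarefree s).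
      by rewrite subUset sub1set inE mi sub_mnmsuppD.
    have D := submK (msquarefree_le sU).
    rewrite yE D cardsU1 iS add1n eqSS.
    have -> // : ((mdeg (m + msquarefree s - msquarefree (i |: s))).+1 == q) = (mdeg m == q).
    have /(congr1 (@mdeg N)) := D; rewrite !mdegD !mdeg_squarefree cardsU1 iS; lia.
  case: ifP => C; first by apply: eq_sdiff => i iS iU; rewrite aux // C.
  rewrite -[RHS](kdiff0 (fun i : 'I_N => (i \in mnmsupp (m + msquarefree s))%:R) s).
  by apply: eq_sdiff => i iS iU; rewrite aux // C.
move=> s m; rewrite mcoeffB kbdyE.
case: and3P => [[/eqP mq /eqP sp /eqP mW]|nC]; last first.
  rewrite subr0 => nz; have [sp mq] := hz _ _ nz; split => //; first exact: wz.
  move=> _; rewrite ltn_neqAle wz // andbT; apply/negP => mW.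
  by apply: nC; rewrite sp mq !eqxx mW.
move=> nz; rewrite mW leqnn; split=> // stm; move: nz.
have := HG (m + msquarefree s)%MM; rewrite mdegD mdeg_squarefree sp mq addnC.
by move=> /(_ erefl mW s (sub_mnmsuppD _ _) sp); rewrite addmK => /(_ stm) ->; rewrite subrr eqxx.
Qed.

(** Descent on the weight lifts exactness from the monomial quotient to [J]. As for a Groebner
    basis, no standard monomial leads an element of [J], and every other monomial is congruent to
    one of smaller weight. *)
Lemma koszul_quotient_exact z : bihomogeneous p q z ->
  (forall t, J (kbd z t)) ->
  exists y, [/\ bihomogeneous p.+1 q.-1 y, (q = 0%N -> forall s, y s = 0) &
    forall s, J (z s - kbd y s)].
Proof.
have [red redP] : exists red : 'X_{1..N} -> 'X_{1..N}, forall m, ~~ std m ->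
    [/\ mdeg (red m) = mdeg m, (mweight (red m) < mweight m)%N & J ('X_[m] - 'X_[red m])].
  suff H m : exists m', ~~ std m ->
      [/\ mdeg m' = mdeg m, (mweight m' < mweight m)%N & J ('X_[m] - 'X_[m'])].
    exists (fun m => sval (constructive_indefinite_description _ (H m))) => m.
    by case: constructive_indefinite_description.
  by case: (boolP (std m)) => [|/J_red[m' Hm']]; [exists 0%MM | exists m'].
move=> hz Jz.
have [W wz] : exists W, forall s m, (z s)@_m != 0 -> (mweight (m + msquarefree s) < W)%N.
  exists (\max_(s : {set 'I_N}) \max_(m <- msupp (z s)) (mweight (m + msquarefree s))).+1.
  move=> s m; rewrite -mcoeff_msupp => ms; rewrite ltnS.
  apply: leq_trans (leq_bigmax s).
  by apply: (@leq_bigmax_seq _ _ xpredT (fun m => mweight (m + msquarefree s))).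
elim: W z hz Jz wz => [|W IH] z hz Jz wz.
  exists (fun=> 0); split=> // [s m|s]; first by rewrite mcoeff0 eqxx.
  rewrite /kbd kdiff0 subr0; suff -> : z s = 0 by [].
  by apply/mpolyP => m; rewrite mcoeff0; apply: contraTeq isT => /wz.
have [y1 [hy1 y10 Hy1]] := koszul_top_weight hz Jz wz.
pose z1 s := z s - kbd y1 s.
(* Only nonstandard terms are left in weight [W]; subtracting [x], which lies in [J], trades them
   for terms of smaller weight. *)
pose E s m := if ~~ std m && (mweight (m + msquarefree s) == W) then (z1 s)@_m else 0.
pose x s := \sum_(m : 'X_{1..N < q.+1}) E s m *: ('X_[m] - 'X_[red m]).
have Jx s : J (x s).
  apply: J_sum => m; rewrite -mul_mpolyC; rewrite /E.
  case: ifP => [/andP[nstd _]|_]; last by rewrite mpolyC0 mul0r.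
  by apply: JM; case: (redP _ nstd).
have xE s m : (x s)@_m = (if (mdeg m < q.+1)%N then E s m else 0) -
    \sum_(m' : 'X_{1..N < q.+1}) E s m' * (red m' == m)%:R.
  rewrite -mcoeff_mpoly_of /mpoly_of /x 2!raddf_sum /= -sumrB; apply: eq_bigr => m' _.
  by rewrite /= !mcoeffZ mcoeffB mulrBr !mcoeffX.
have z1W s m : (z1 s)@_m != 0 -> [/\ #|s| = p, mdeg m = q,
    (mweight (m + msquarefree s) <= W)%N & std m -> (mweight (m + msquarefree s) < W)%N].
  exact: Hy1.
have redE s m : \sum_(m' : 'X_{1..N < q.+1}) E s m' * (red m' == m)%:R != 0 ->
    [/\ #|s| = p, mdeg m = q & (mweight (m + msquarefree s) < W)%N].
  move=> nz; have [m' Em'] : exists m' : 'X_{1..N < q.+1}, E s m' * (red m' == m)%:R != 0.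
    apply/existsP; apply: contraR nz; rewrite negb_exists => /forallP H.
    by rewrite big1 // => m' _; apply/eqP/negPn/H.
  move: Em'; rewrite /E; case: ifP => [/andP[nstd /eqP mW]|_]; last by rewrite mul0r eqxx.
  case: (red m' =P m) => [<-|_]; last by rewrite mulr0 eqxx.
  rewrite mulr1 => /z1W[sp mq _ _]; case: (redP _ nstd) => dm lt _; split; rewrite ?dm //.
  by rewrite -mW !mweightD ltn_add2r.
pose z2 s := z1 s - x s.
have [||s m|y2 [hy2 y20 Hy2]] := IH z2.
- move=> s m; rewrite mcoeffB xE opprB addrCA => nz.
  have [S0|/redE[]//] := eqVneq (\sum_(m' : 'X_{1..N < q.+1}) E s m' * (red m' == m)%:R) 0.
  have [/eqP z10|/z1W[]//] := boolP ((z1 s)@_m == 0).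
  by move: nz; rewrite S0 z10 /E z10 !if_same subrr addr0 eqxx.
- move=> t; rewrite /kbd kdiffB; apply: JD; last by apply: J_opp; apply: J_kbd.
  by rewrite kdiffB kdiff_kdiff subr0; apply: Jz.
- rewrite mcoeffB xE opprB addrCA => nz.
  have [S0|/redE[]//] := eqVneq (\sum_(m' : 'X_{1..N < q.+1}) E s m' * (red m' == m)%:R) 0.
  move: nz; rewrite S0 add0r /E => nz.
  have z1n0 : (z1 s)@_m != 0.
    by apply: contraNneq nz => ->; rewrite !if_same subrr.
  have [_ mq leW ltW] := z1W _ _ z1n0.
  case: (boolP (std m)) => [/ltW //|nstd]; move: nz; rewrite nstd mq ltnSn /=.
  rewrite ltn_neqAle leW andbT; case: (mweight _ =P W) => // _; by rewrite subrr eqxx.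
exists (fun s => y1 s + y2 s); split.
- move=> s m; rewrite mcoeffD; have [->|/hy1 //] := eqVneq (y1 s)@_m 0.
  by rewrite add0r => /hy2.
- by move=> q0 s; rewrite y10 ?y20 ?addr0.
- move=> s; rewrite /kbd kdiffD.
  rewrite (_ : _ - _ = x s + (z2 s - kbd y2 s)); first exact: JD.
  by rewrite /z2 /z1 /kbd; ring.
Qed.

End KoszulPolynomials.

(** * From Koszul homology to minimal free resolutions *)

Section Zigzag.

Variables (N : nat) (k : fieldType).
Local Notation S := {mpoly k[N]}.
Implicit Types s t : {set 'I_N}.

(** The case [J = 0] with zero weights and all monomials standard. In a nonzero multidegree all
    subsets of the support occur, and any support element is the apex of a cone. *)
Lemma koszul_exact p q (z : {set 'I_N} -> S) : bihomogeneous p q z ->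
  (0 < p + q)%N -> (forall t, kbd z t = 0) ->
  exists y, [/\ bihomogeneous p.+1 q.-1 y, (q = 0%N -> forall s, y s = 0) &
    forall s, z s = kbd y s].
Proof.
move=> hz pq zc.
have [|||||mu dmu f Hf||y [hy y0 Hy]] :=
  @koszul_quotient_exact N k (fun=> 0%N) (eq^~ 0) xpredT _ _ _ _ _ p q _ z hz.
- by [].
- by move=> a b -> ->; rewrite addr0.
- by move=> a b ->; rewrite mulr0.
- by move=> x m -> _ _; rewrite mcoeff0.
- by [].
- have [v vmu] : exists v, v \in mnmsupp mu.
    apply/set0Pn/negP => /eqP mu0; have : mdeg mu == 0%N.
      rewrite mdeg_eq0; apply/eqP/mnmP => i; rewrite mnm0E.
      by have := in_set0 i; rewrite -mu0 inE; case: (mu i).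
    by rewrite dmu; case: (p + q)%N pq.
  exists (fun s => if v \in s then ksign k v (s :\ v) * f (s :\ v) else 0).
  move=> s sU _ _; rewrite sdiff_cone // => vs; apply: Hf => //.
  exact: subset_trans (subD1set _ _) sU.
- exact: zc.
- by exists y; split=> // s; apply/eqP; rewrite -subr_eq0; apply/eqP.
Qed.

Lemma homogz0 d : homogz d (0 : S).
Proof. by case: d => //= n; apply: dhomog0. Qed.

Lemma homogzD d (p q : S) : homogz d p -> homogz d q -> homogz d (p + q).
Proof.
case: d => n /=; first exact: dhomogD.
by move=> -> ->; rewrite addr0.
Qed.

Lemma homogzM d d' (p q : S) :
  homogz d p -> homogz d' q -> homogz (d + d') (p * q).
Proof.
case: d => n /=; last by move=> -> _; rewrite mul0r; apply: homogz0.
case: d' => n' /= hp; last by move=> ->; rewrite mulr0; apply: homogz0.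
by move=> hq; apply: dhomogM.
Qed.

Lemma homogz_sum (I : finType) d (F : I -> S) :
  (forall i, homogz d (F i)) -> homogz d (\sum_i F i).
Proof.
by move=> H; apply: (big_ind (homogz d)) => //; [apply: homogz0 | apply: homogzD].
Qed.

Lemma homogz_coeff n (p : S) : (forall m, p@_m != 0 -> mdeg m = n) -> homogz n p.
Proof. by move=> H; apply/dhomogP => m; rewrite mcoeff_msupp; apply: H. Qed.

Definition kvbd n (z : {set 'I_N} -> 'rV[S]_n) t : 'rV[S]_n :=
  \sum_(i | i \notin t) (ksign S i t * 'X_i) *: z (i |: t).

Lemma kvbdE n (z : {set 'I_N} -> 'rV[S]_n) t b :
  kvbd z t 0 b = kbd (fun s => z s 0 b) t.
Proof. by rewrite summxE; apply: eq_bigr => i _; rewrite mxE. Qed.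

Lemma kvbd_mulmx n n' (z : {set 'I_N} -> 'rV[S]_n) (A : 'M_(n, n')) t :
  kvbd z t *m A = kvbd (fun s => z s *m A) t.
Proof. by rewrite mulmx_suml; apply: eq_bigr => i _; rewrite scalemxAl. Qed.

(* Vanishing of the Koszul homology, in homological degree p and internal
   degree D, of the quotient of a free module with shifts sh by Im. *)
Definition koszul_vanishes n (sh : 'I_n -> int) (Im : 'rV[S]_n -> Prop)
    (p : nat) (D : int) : Prop :=
  forall z : {set 'I_N} -> 'rV[S]_n, (forall s, #|s| != p -> z s = 0) ->
  (forall s b, homogz (D - p%:Z - sh b) (z s 0 b)) ->
  (forall t, Im (kvbd z t)) ->
  exists y, forall s, Im (z s - kvbd y s).

Lemma eq_koszul_vanishes n (sh : 'I_n -> int) Im Im' p D :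
  (forall v, Im v <-> Im' v) ->
  koszul_vanishes sh Im p D -> koszul_vanishes sh Im' p D.
Proof.
move=> E H z z1 z2 z3; have [|y Hy] := H z z1 z2; first by move=> t; apply/E.
by exists y => s; apply/E.
Qed.

(** One zigzag step. Since [z] is a cycle modulo the kernel of [A], [z *m A] is a true cycle, hence
    a boundary of some [u]; this [u] is a cycle modulo the image of [A], and vanishing one Koszul
    degree higher applies to it. *)
Lemma koszul_vanishes_syzygy a b (sha : 'I_a -> int) (shb : 'I_b -> int)
    (Im : 'rV[S]_b -> Prop) (A : 'M[S]_(a, b)) p D :
  (forall v, Im v <-> exists u, v = u *m A) ->
  (forall x y, homogz (sha x - shb y) (A x y)) ->
  (forall x y, (A x y)@_0%MM = 0) ->
  koszul_vanishes shb Im p.+1 D ->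
  koszul_vanishes sha (fun v => v *m A = 0) p D.
Proof.
move=> ImE hA A0 van z z0 hz zc.
have [U HU] : exists U : 'I_b -> {set 'I_N} -> S, forall y,
    [/\ forall s, #|s| != p.+1 -> U y s = 0,
        forall s, homogz (D - p.+1%:Z - shb y) (U y s) &
        forall s, (z s *m A) 0 y = kbd (U y) s].
  apply: (@fin_all_exists _ _ (fun (y : 'I_b) (u : {set 'I_N} -> S) =>
    [/\ forall s, #|s| != p.+1 -> u s = 0,
        forall s, homogz (D - p.+1%:Z - shb y) (u s) &
        forall s, (z s *m A) 0 y = kbd u s])) => y.
  have hzA s : homogz (D - p%:Z - shb y) ((z s *m A) 0 y).
    rewrite mxE; apply: homogz_sum => x.
    have -> : D - p%:Z - shb y = (D - p%:Z - sha x) + (sha x - shb y) by ring.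
    exact: homogzM.
  have zA0 s : #|s| != p -> (z s *m A) 0 y = 0 by move=> /z0 ->; rewrite mul0mx mxE.
  have zAc t : kbd (fun s => (z s *m A) 0 y) t = 0.
    by rewrite -kvbdE -kvbd_mulmx zc mxE.
  have case0 : (forall s, (z s *m A) 0 y = 0) -> exists u : {set 'I_N} -> S,
      [/\ forall s, #|s| != p.+1 -> u s = 0,
        forall s, homogz (D - p.+1%:Z - shb y) (u s) &
        forall s, (z s *m A) 0 y = kbd u s].
    move=> H; exists (fun=> 0); split=> // s; first exact: homogz0.
    by rewrite /kbd kdiff0.
  case E : (D - p%:Z - shb y) => [q|q] in hzA; last exact: case0.
  (* In bidegree (0, 0) Koszul exactness fails, but there the entry is a constant, and it is zero
     because [A] has no constant terms. *)
  case: (posnP (p + q)) => [pq0|pq].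
    have [p0 q0] : p = 0%N /\ q = 0%N by lia.
    apply: case0 => s; apply/mpolyP => m; rewrite mcoeff0.
    case: (m =P 0%MM) => [->|/eqP m0].
      rewrite mxE raddf_sum big1 // => x _ /=.
      have /= -> := rmorphM (mcoeff 0%MM : {rmorphism S -> k}) (z s 0 x) (A x y).
      by rewrite A0 mulr0.
    have /= := hzA s; rewrite q0 => /dhomog_nemf_coeff; apply.
    by rewrite mdeg_eq0.
  have hb : bihomogeneous p q (fun s => (z s *m A) 0 y).
    move=> s m nz; split.
      by apply/eqP; apply: contraNT nz => /zA0 ->; rewrite mcoeff0.
    by have /dhomogP := hzA s; apply; rewrite mcoeff_msupp.
  have [u [hu u0 uE]] := koszul_exact hb pq zAc.
  exists u; split=> // s.
    move=> sp; apply/mpolyP => m; rewrite mcoeff0; apply/eqP.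
    by apply: contraNT sp => /hu[-> _].
  have [q0|q0] := posnP q; first by rewrite u0 //; apply: homogz0.
  have -> : D - p.+1%:Z - shb y = q.-1%:Z by lia.
  by apply: homogz_coeff => m /hu[].
pose u s : 'rV[S]_b := \row_y U y s.
have uE s : kvbd u s = z s *m A.
  apply/rowP => y; have [_ _ ->] := HU y; rewrite kvbdE.
  by apply: eq_kdiff => i _; rewrite mxE.
have [||t|v Hv] := van u.
- by move=> s sp; apply/rowP => y; rewrite !mxE; have [->] := HU y.
- by move=> s y; rewrite mxE; have [_ H _] := HU y.
- by apply/ImE; exists (z t).
have [w Hw] : exists w : {set 'I_N} -> 'rV[S]_a,
    forall s, u s - kvbd v s = w s *m A.
  apply: (@fin_all_exists _ _ (fun s x => u s - kvbd v s = x *m A)) => s.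
  by apply/ImE.
(* Applying the differential to [u - kvbd v = w *m A] gives [z *m A = kvbd w *m A]. *)
exists w => s; rewrite mulmxBl kvbd_mulmx -uE; apply/rowP => y.
rewrite !mxE !kvbdE -kdiffB.
under eq_kdiff => i _ do rewrite -Hw !mxE opprB addrCA subrr addr0 kvbdE.
exact: kdiff_kdiff.
Qed.

Variables (F : free_complex N k) (I : pred S).
Hypothesis hF : graded_minimal_free_resolution F I.
Hypothesis I0 : forall p, I p -> p@_0%MM = 0.

(** Each syzygy step trades one step of the resolution for one Koszul degree, down to the quotient
    of the ring by [I]. *)
Lemma koszul_vanishes_resolution i p D :
  koszul_vanishes (fun=> 0 : int) (fun v : 'rV[S]_1 => I (v 0 0)) (p + i.+1) D ->
  koszul_vanishes (@fshift _ _ F i) (fun v => exists u, v = u *m fdiff F i) p D.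
Proof.
have [[haug hdiff] [rI r0 rS] min] := hF.
elim: i p => [|i IH] p van.
  rewrite addn1 in van; apply: (eq_koszul_vanishes r0).
  apply: (koszul_vanishes_syzygy _ _ _ van) => [v|x y|x y].
  - rewrite rI; split=> [[u uE]|[u uE]]; exists u; rewrite uE;
    exact: mx11_scalar.
  - by rewrite subr0 ord1; apply: haug.
  (* The entries of the augmentation are elements of [I], which gives them zero constant term. *)
  - rewrite ord1; apply: I0; apply/rI; exists (delta_mx 0 x).
    by rewrite -rowE [LHS]mx11_scalar mxE.
apply: (eq_koszul_vanishes (rS i)).
apply: (koszul_vanishes_syzygy _ _ (min i) (IH p.+1 _)) => //.
by rewrite addSnnS.
Qed.

(** The basis vector [a] is a cycle of Koszul degree 0. As a boundary modulo the image of
    [fdiff F i] it would have zero constant term, since neither the variables nor the entries of a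
    minimal complex have one. *)
Lemma koszul_vanishing_betti i (a : 'I_(frank F i)) q :
  fshift a = (i.+1 + q)%N ->
  (forall z, bihomogeneous i.+1 q z -> (forall t, I (kbd z t)) ->
     exists y, forall s, I (z s - kbd y s)) -> False.
Proof.
move=> aq van; have [_ [rI _ _] min] := hF.
have base : koszul_vanishes (fun=> 0 : int) (fun v : 'rV[S]_1 => I (v 0 0))
    (0 + i.+1) (fshift a).
  move=> z z0 hz zc.
  have [|t|y Hy] := van (fun s => z s 0 0).
  - move=> s m nz; split.
      by apply/eqP; apply: contraNT nz => /z0 ->; rewrite mxE mcoeff0.
    have := hz s 0; rewrite aq subr0 add0n.
    have -> : (i.+1 + q)%N%:Z - i.+1%:Z = q%:Z by lia.
    by move=> /dhomogP; apply; rewrite mcoeff_msupp.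
  - by rewrite -kvbdE.
  exists (fun s => (y s)%:M) => s; rewrite mxE mxE kvbdE.
  have -> // : kbd (fun s0 => (y s0)%:M (0 : 'I_1) 0) s = kbd y s.
  by apply: eq_kdiff => j _; rewrite mxE eqxx mulr1n.
have [|||y Hy] := koszul_vanishes_resolution base
  (z := fun s => if s == set0 then delta_mx 0 a else 0).
- by move=> s; rewrite cards_eq0 => /negbTE ->.
- move=> s b; case: ifP => _; last by rewrite mxE; apply: homogz0.
  rewrite mxE eqxx /= subr0; case: eqP => [->|_]; last exact: homogz0.
  by rewrite subrr; apply: dhomog1.
- move=> t; exists 0; rewrite mul0mx /kvbd big1 // => j _.
  case: eqP => [j0|_]; last by rewrite scaler0.
  by have := setU11 j t; rewrite j0 inE.
have [u /rowP/(_ a)/(congr1 (mcoeff 0%MM))] := Hy set0.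
rewrite eqxx !mxE !eqxx mcoeffB kvbdE mcoeff1 eqxx.
rewrite [X in _ - X](_ : _ = 0); last first.
  rewrite raddf_sum big1 // => j _ /=.
  by rewrite -mulrA mcoeff_ksignM mcoeff_mulXi mnm0E mulr0.
rewrite raddf_sum big1 /= => [|j _].
  by rewrite subr0 => /eqP; rewrite oner_eq0.
have /= -> := rmorphM (mcoeff 0%MM : {rmorphism S -> k}) (u 0 j) (fdiff F i j a).
by rewrite min mulr0.
Qed.

End Zigzag.

(** * Doubly lexical orderings of chordal bipartite graphs *)

Section DoublyLexical.

Variables (V : finType) (e : rel V).
Hypotheses (e_sym : ssrbool.symmetric e) (e_irr : irreflexive e).

Definition nbr_sum (a : V -> int) u : int := \sum_z (e u z)%:R * a z.

(** The quadratic form of the adjacency matrix. *)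
Definition edge_form (a : V -> int) : int := \sum_u a u * nbr_sum a u.

(** Expand the form bilinearly: symmetry gives the factor 2, and the quadratic term in [d] vanishes
    because [u] and [u'] are nonadjacent and there are no loops. *)
Lemma edge_form_swap (a : V -> int) u u' d : ~~ e u u' ->
  edge_form (fun x => a x + d * ((x == u)%:R - (x == u')%:R)) =
  edge_form a + d * (nbr_sum a u - nbr_sum a u') *+ 2.
Proof.
move=> nuu'; pose b x : int := (x == u)%:R - (x == u')%:R.
have sumb (g : V -> int) : \sum_x b x * g x = g u - g u'.
  have delta v : \sum_x (x == v)%:R * g x = g v.
    rewrite (bigD1 v) //= eqxx mul1r big1 ?addr0 // => x /negbTE ->.
    by rewrite mul0r.
  by rewrite -!delta -sumrB; apply: eq_bigr => x _; rewrite mulrBl.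
have nbrb x : nbr_sum b x = (e x u)%:R - (e x u')%:R.
  by rewrite -(sumb (fun v => (e x v)%:R)); apply: eq_bigr => z _; rewrite mulrC.
have nbrD x : nbr_sum (fun x => a x + d * b x) x = nbr_sum a x + d * nbr_sum b x.
  rewrite /nbr_sum mulr_sumr -big_split; apply: eq_bigr => z _ /=; ring.
have sa : \sum_x a x * nbr_sum b x = nbr_sum a u - nbr_sum a u'.
  rewrite -sumrB; apply: eq_bigr => x _; rewrite nbrb ![e x _]e_sym; ring.
have sb : \sum_x b x * nbr_sum b x = 0.
  by rewrite sumb !nbrb !e_irr (e_sym u') (negbTE nuu') !subrr.
transitivity (\sum_x (a x * nbr_sum a x + d * (b x * nbr_sum a x) +
    d * (a x * nbr_sum b x) + d * d * (b x * nbr_sum b x))).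
  by apply: eq_bigr => x _; rewrite nbrD -/(b x); ring.
rewrite !big_split /= -!mulr_sumr sumb sa sb; rewrite /edge_form; ring.
Qed.

Definition perm_rank (s : {perm V}) (v : V) : nat := enum_rank (s v).

Lemma perm_rank_inj s : injective (perm_rank s).
Proof. by move=> u v /val_inj/enum_rank_inj/perm_inj. Qed.

(** Powers of two turn the comparison of neighbour sums into a lexicographic comparison of
    neighbourhoods, largest rank first. *)
Definition rank_weight (r : V -> nat) u : int := 2%:R ^+ r u.

(* Exchanging the ranks of two nonadjacent vertices changes the edge form by
   twice the product of the weight difference and the neighbour-sum difference,
   so neighbour sums increase with the rank at a maximum. *)
Lemma exists_lexical_rank : exists2 r : V -> nat, injective r &
  forall u u', ~~ e u u' -> (r u < r u')%N ->
    nbr_sum (rank_weight r) u <= nbr_sum (rank_weight r) u'.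
Proof.
pose Phi s := edge_form (rank_weight (perm_rank s)).
pose s := [arg max_(s > (1%g : {perm V})) Phi s]%O.
have smax t : Phi t <= Phi s by rewrite /s; case: arg_maxP => // i _; apply.
exists (perm_rank s) => [|u u' nuu' ltr]; first exact: perm_rank_inj.
set a := rank_weight _.
have ltuu' : a u < a u' by rewrite /a /rank_weight ltr_eXn2l.
have := smax (tperm u u' * s)%g; rewrite {1}/Phi.
have -> : edge_form (rank_weight (perm_rank (tperm u u' * s)%g)) =
    edge_form (fun x => a x + (a u' - a u) * ((x == u)%:R - (x == u')%:R)).
  have E x : rank_weight (perm_rank (tperm u u' * s)%g) x =
      a x + (a u' - a u) * ((x == u)%:R - (x == u')%:R).
    rewrite /a /rank_weight /perm_rank permM; case: tpermP => [->|->|/eqP xu /eqP xu'].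
    - have -> : (u == u') = false.
        by apply/eqP => uu'; rewrite uu' ltnn in ltr.
      by rewrite eqxx subr0 mulr1 addrC subrK.
    - have -> : (u' == u) = false.
        by apply/eqP => uu'; rewrite uu' ltnn in ltr.
      by rewrite eqxx sub0r mulrN1 opprB addrC subrK.
    - by rewrite (negbTE xu) (negbTE xu') subrr mulr0 addr0.
  rewrite /edge_form; apply: eq_bigr => x _; rewrite E; congr (_ * _).
  by apply: eq_bigr => y _; rewrite E.
rewrite edge_form_swap // -/a -/(Phi s) gerDl => H.
rewrite -subr_le0 -(pmulr_rle0 _ (x := a u' - a u)) ?subr_gt0 //.
by move: H; rewrite pmulrn_lle0.
Qed.

Lemma sum_rank_weight_lt (r : V -> nat) n : injective r ->
  \sum_(z | (r z < n)%N) rank_weight r z < 2%:R ^+ n.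
Proof.
move=> r_inj; elim: n => [|n IH]; first by rewrite big_pred0.
rewrite exprS mulr2n mulrDl !mul1r.
rewrite (bigID (fun z => (r z < n)%N)) /=.
apply: ltr_leD.
  rewrite (eq_bigl (fun z => r z < n)%N) // => z.
  by case: (ltnP (r z) n); rewrite ?andbF // => /leqW ->.
case: (pickP (fun z => r z == n)) => [z0 /eqP rz0|no].
  rewrite (big_pred1 z0) ?/rank_weight ?rz0 // => z.
  by rewrite ltnS -leqNgt -eqn_leq -rz0 (inj_eq r_inj).
rewrite big_pred0 ?exprn_ge0 // => z; have := no z.
by rewrite ltnS -leqNgt -eqn_leq.
Qed.

(** Take for [z'] the vertex of largest rank where the neighbourhoods differ. Its weight exceeds the
    total of all lower ones, so it must be a neighbour of [u']. *)
Lemma lexical_witness (r : V -> nat) u u' z : injective r ->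
  nbr_sum (rank_weight r) u <= nbr_sum (rank_weight r) u' ->
  e u z -> ~~ e u' z ->
  exists z', [/\ (r z < r z')%N, e u' z', ~~ e u z' &
    forall w, (r z' < r w)%N -> e u w = e u' w].
Proof.
move=> r_inj le_c uz nu'z.
have Pz : e u z != e u' z by rewrite uz (negbTE nu'z).
pose z' := [arg max_(x > z | e u x != e u' x) r x].
have [ne zmax] : e u z' != e u' z' /\ forall x, e u x != e u' x -> (r x <= r z')%N.
  by rewrite /z'; case: arg_maxnP.
have agree w : (r z' < r w)%N -> e u w = e u' w.
  by move=> lt; apply/eqP; apply: contraTT lt => /zmax; rewrite -leqNgt.
case: (boolP (e u z')) => uz'; last first.
  have u'z' : e u' z' by move: ne; rewrite (negbTE uz'); case: (e u' z').
  exists z'; split=> //; rewrite ltn_neqAle zmax // andbT.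
  by apply: contraNneq nu'z => /r_inj ->.
have nu'z' : e u' z' = false by move: ne; rewrite uz'; case: (e u' z').
suff : nbr_sum (rank_weight r) u' - nbr_sum (rank_weight r) u < 0.
  by rewrite subr_lt0 ltNge le_c.
rewrite -sumrB (bigD1 z') //= uz' nu'z' mul0r mul1r sub0r addrC subr_lt0.
apply: le_lt_trans (sum_rank_weight_lt (r z') r_inj).
rewrite [X in _ <= X](big_mkcond) [X in X <= _](big_mkcond); apply: ler_sum => x _.
have w0 : 0 <= rank_weight r x by rewrite exprn_ge0.
case: eqP => [->|/eqP xz'] /=; first by rewrite ltnn.
have [lt|gt|/r_inj xz] := ltngtP (r x) (r z'); last by rewrite xz eqxx in xz'.
  case: (e u' x); case: (e u x); rewrite ?mul1r ?mul0r ?subrr ?subr0 ?sub0r //.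
  by apply: (le_trans _ (w0)); rewrite oppr_le0.
by rewrite agree // subrr.
Qed.

Variable side : pred V.
Hypothesis side_e : forall u v, e u v -> side u != side v.
Hypothesis chordal : forall (l : nat) (c : 'I_l -> V), (6 <= l)%N -> ~ induced_cycle e c.

(** The induced cycle is [R 0], [C 1], [R 2], ... up to level [n - 1] and back down to [C 0], with
    [lev] as the level. The two end edges join equal levels, and [3 <= n] makes the length at least
    6. *)
Lemma no_ladder n (R C : nat -> V) (r : V -> nat) : (3 <= n)%N ->
  (forall i j, (i < j < n)%N -> (r (R i) < r (R j))%N) ->
  (forall i j, (i < j < n)%N -> (r (C i) < r (C j))%N) ->
  (forall i, (i < n)%N -> side (R i)) -> (forall i, (i < n)%N -> ~~ side (C i)) ->
  (forall i j, (i < n)%N -> (j < n)%N -> e (R i) (C j) =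
    [|| i.+1 == j, j.+1 == i | (i == j) && ((i == 0) || (i.+1 == n))%N]) -> False.
Proof.
move=> n3 rR rC sR sC eRC.
pose lev t := if (t < n)%N then t else ((n + n).-1 - t)%N.
have levn (t : 'I_(n + n)) : (lev t < n)%N.
  have tn := ltn_ord t; rewrite /lev; case: (ltnP t n) => // nt; lia.
pose c (t : 'I_(n + n)) := if odd t then C (lev t) else R (lev t).
have same_side u v : side u = side v -> e u v = false.
  by move=> uv; apply/negbTE/negP => /side_e; rewrite uv eqxx.
have RR i j : (i < n)%N -> (j < n)%N -> e (R i) (R j) = false.
  by move=> iN jN; apply: same_side; rewrite !sR.
have CC i j : (i < n)%N -> (j < n)%N -> e (C i) (C j) = false.
  by move=> iN jN; apply: same_side; rewrite !(negbTE (sC _ _)).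
have injR i j : (i < n)%N -> (j < n)%N -> R i = R j -> i = j.
  move=> iN jN E; have [lt|lt|//] := ltngtP i j.
    by have := rR i j; rewrite lt jN E ltnn => /(_ isT).
  by have := rR j i; rewrite lt iN E ltnn => /(_ isT).
have injC i j : (i < n)%N -> (j < n)%N -> C i = C j -> i = j.
  move=> iN jN E; have [lt|lt|//] := ltngtP i j.
    by have := rC i j; rewrite lt jN E ltnn => /(_ isT).
  by have := rC j i; rewrite lt iN E ltnn => /(_ isT).
have l6 : (6 <= n + n)%N by lia.
apply: (chordal (c := c) l6); split=> [t t'|t t'].
  have E : forall t t' : 'I_(n + n), odd t = odd t' -> lev t = lev t' -> t = t'.
    move=> {}t {}t' ot; have := odd_double_half t; have := odd_double_half t'.
    have := ltn_ord t; have := ltn_ord t'; rewrite ot /lev => ? ? ? ? H.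
    by apply: val_inj; move: H => /=; case: (ltnP t n) => ?; case: (ltnP t' n) => ?; lia.
  rewrite /c; case: (boolP (odd t)) => ot; case: (boolP (odd t')) => ot'.
  - by move=> /injC H; apply: E; rewrite ?ot ?ot' // H.
  - move=> H; have := sC _ (levn t); rewrite H sR //.
  - move=> H; have := sC _ (levn t'); rewrite -H sR //.
  - by move=> /injR H; apply: E; rewrite ?(negbTE ot) ?(negbTE ot') // H.
have ordSE (a b : 'I_(n + n)) : (ordS a == b) = (a.+1 == b) || (a.+1 == (n + n)%N) && (b == 0 :> nat).
  rewrite -val_eqE /=; have := ltn_ord a; have := ltn_ord b => bn an.
  have [lt|ge] := ltnP a.+1 (n + n)%N; first by rewrite modn_small //; lia.
  by have -> : a.+1 = (n + n)%N by [lia]; rewrite modnn; lia.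
have h1 := odd_double_half t; have h2 := odd_double_half t'.
have t1 := ltn_ord t; have t2 := ltn_ord t'.
rewrite !ordSE /c; case: (boolP (odd t)) h1 => ot h1; case: (boolP (odd t')) h2 => ot' h2.
- by rewrite CC //; move: h1 h2 => /=; lia.
- rewrite e_sym eRC //; rewrite /lev; move: h1 h2 => /=.
  by case: (ltnP t n) => ?; case: (ltnP t' n) => ?; lia.
- rewrite eRC //; rewrite /lev; move: h1 h2 => /=.
  by case: (ltnP t n) => ?; case: (ltnP t' n) => ?; lia.
- by rewrite RR //; move: h1 h2 => /=; lia.
Qed.

(* A violation grows into a ladder R 0, R 1, ... and C 0, C 1, ... of increasing
   rank; an edge between its two ends would close an induced cycle. *)
Lemma gamma_free_rank : exists2 r : V -> nat, injective r &
  forall u u' z z', (r u < r u')%N -> (r z < r z')%N ->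
    e u z -> e u z' -> e u' z -> e u' z'.
Proof.
have [r r_inj r_lex] := exists_lexical_rank; exists r => //.
(* If [u] is not on the chosen side then [z] is, and the claim is symmetric in the two pairs. *)
suff main u u' z z' : side u -> (r u < r u')%N -> (r z < r z')%N ->
    e u z -> e u z' -> e u' z -> e u' z'.
  move=> u u' z z' ruu' rzz' uz uz' u'z.
  case: (boolP (side u)) => su; first exact: main ruu' rzz' uz uz' u'z.
  have sz : side z by have := side_e uz; rewrite (negbTE su); case: (side z).
  by rewrite e_sym; apply: main rzz' ruu' _ _ _ => //; rewrite e_sym.
move=> su ruu' rzz' uz uz' u'z; apply/negPn/negP => nu'z'.
have same_side a b : side a = side b -> e a b = false.
  by move=> ab; apply/negbTE/negP => /side_e; rewrite ab eqxx.
have opp a b : e a b -> side b = ~~ side a.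
  by move=> /side_e; case: (side a); case: (side b).
have step a b x : side a = side b -> (r a < r b)%N -> e a x -> ~~ e b x ->
  exists y, [/\ (r x < r y)%N, e b y, ~~ e a y & forall w, (r y < r w)%N -> e a w = e b w].
  move=> sab rab; apply: lexical_witness => //; apply: r_lex => //.
  by rewrite same_side.
(* The last two clauses, on agreement of consecutive neighbourhoods above the next level, carry a
   missing edge down the ladder. *)
pose ladder n (R C : nat -> V) := [/\
  forall i j, (i < j < n)%N -> (r (R i) < r (R j))%N /\ (r (C i) < r (C j))%N,
  forall i, (i < n)%N -> side (R i) /\ ~~ side (C i),
  forall i j, (i < n)%N -> (j < n)%N -> e (R i) (C j) =
    [|| i.+1 == j, j.+1 == i | (i == j) && (i == 0)]%N,
  forall i w, (i.+2 < n)%N -> (r (C i.+2) < r w)%N -> e (R i) w = e (R i.+1) w &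
  forall i w, (i.+2 < n)%N -> (r (R i.+2) < r w)%N -> e (C i) w = e (C i.+1) w].
(* Such a ladder has more distinct rows than [V] has vertices. *)
suff [R [C [rRC _ _ _ _]]] : exists R C, ladder (#|V|.+1).+2 R C.
  have rR i j (ijn : (i < j < #|V|.+3)%N) : (r (R i) < r (R j))%N by case: (rRC i j ijn).
  have inj : injective (fun i : 'I_(#|V|.+3) => R i).
    move=> i j E; apply: val_inj => /=; have [lt|lt|//] := ltngtP i j.
      by have := rR i j; rewrite lt ltn_ord E ltnn => /(_ isT).
    by have := rR j i; rewrite lt ltn_ord E ltnn => /(_ isT).
  have := leq_card _ inj; rewrite card_ord; lia.
elim: (#|V|.+1) => [|d [R [C [rRC sRC eRC aR aC]]]].
  exists (fun i => if i == 0%N then u else u'), (fun i => if i == 0%N then z else z').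
  have su' : side u'.
    by have := opp _ _ u'z; rewrite (opp _ _ uz) su; case: (side u').
  split=> //.
  - by move=> i j ijn; have [-> ->] : i = 0%N /\ j = 1%N by lia.
  - by move=> [|[|i]] // _; rewrite ?(opp _ _ uz) ?(opp _ _ uz') ?su ?su'.
  - by move=> [|[|i]] [|[|j]] //= _ _; apply/negbTE.
have [dn d1n] : (d < d.+2)%N /\ (d.+1 < d.+2)%N by [].
set n := d.+2 in rRC sRC eRC aR aC dn d1n *.
have rR i j (ijn : (i < j < n)%N) : (r (R i) < r (R j))%N by case: (rRC i j ijn).
have rC i j (ijn : (i < j < n)%N) : (r (C i) < r (C j))%N by case: (rRC i j ijn).
have sR i (iN : (i < n)%N) : side (R i) by case: (sRC i iN).
have sC i (iN : (i < n)%N) : ~~ side (C i) by case: (sRC i iN).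
(* [C d.+1] is adjacent to [R d] but not to [R d.+1], so the lexical order yields a column [y]
   beyond it. The new row [x] arises in the same way. *)
have [y [ry y1 y0 ay]] : exists y, [/\ (r (C d.+1) < r y)%N, e (R d.+1) y,
    ~~ e (R d) y & forall w, (r y < r w)%N -> e (R d) w = e (R d.+1) w].
  apply: step; [by rewrite !sR | by apply: rR; rewrite !ltnSn | |];
  rewrite eRC //; lia.
have [x [rx x1 x0 ax]] : exists x, [/\ (r (R d.+1) < r x)%N, e (C d.+1) x,
    ~~ e (C d) x & forall w, (r x < r w)%N -> e (C d) w = e (C d.+1) w].
  apply: step; [by rewrite !(negbTE (sC _ _)) | by apply: rC; rewrite !ltnSn | |];
  rewrite e_sym eRC //; lia.
have sx : side x by rewrite (opp _ _ x1) sC.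
have sy : ~~ side y by rewrite (opp _ _ y1) sR.
have ltR j : (j < n)%N -> (r (R j) < r x)%N.
  rewrite ltnS leq_eqVlt => /orP[/eqP -> //|jd].
  by apply: ltn_trans rx; apply: rR; rewrite jd ltnSn.
have ltC j : (j < n)%N -> (r (C j) < r y)%N.
  rewrite ltnS leq_eqVlt => /orP[/eqP -> //|jd].
  by apply: ltn_trans ry; apply: rC; rewrite jd ltnSn.
have far i (P : bool) : (i <= d)%N ->
    [|| i.+1 == d.+2, d.+3 == i | (i == d.+2) && P]%N = false.
  by move=> id; rewrite !eqn_leq; clear -id; case: P; lia.
(* Descend from [R d]: consecutive rows agree on [y], which ranks above all columns. *)
have Ry i : (i <= d)%N -> e (R i) y = false.
  move=> /subnKC; move: (d - i)%N => j; elim: j i => [|j IH] i ji.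
    by rewrite addn0 in ji; rewrite ji (negbTE y0).
  have lt_i : (i.+2 < n)%N by rewrite /n -ji !addnS !ltnS leq_addr.
  by rewrite aR ?ltC // IH // addSnnS.
have Cx i : (i <= d)%N -> e (C i) x = false.
  move=> /subnKC; move: (d - i)%N => j; elim: j i => [|j IH] i ji.
    by rewrite addn0 in ji; rewrite ji (negbTE x0).
  have lt_i : (i.+2 < n)%N by rewrite /n -ji !addnS !ltnS leq_addr.
  by rewrite aC ?ltR // IH // addSnnS.
pose R' i := if i == n then x else R i.
pose C' i := if i == n then y else C i.
have R'E i : (i < n)%N -> R' i = R i by rewrite /R'; case: eqP => // ->; rewrite ltnn.
have C'E i : (i < n)%N -> C' i = C i by rewrite /C'; case: eqP => // ->; rewrite ltnn.
have R'n : R' n = x by rewrite /R' eqxx.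
have C'n : C' n = y by rewrite /C' eqxx.
have lastE (P : nat -> Prop) : (forall i, (i < n)%N -> P i) -> P n ->
    forall i, (i < n.+1)%N -> P i.
  by move=> P1 P2 i; rewrite ltnS leq_eqVlt => /orP[/eqP ->|/P1].
have rR' i j : (i < j < n.+1)%N -> (r (R' i) < r (R' j))%N.
  case/andP=> ij jn; rewrite (R'E i) ?(leq_trans ij) //.
  move: j jn ij; apply: lastE => [j jn ij|ij]; first by rewrite R'E // rR // ij.
  by rewrite R'n ltR.
have rC' i j : (i < j < n.+1)%N -> (r (C' i) < r (C' j))%N.
  case/andP=> ij jn; rewrite (C'E i) ?(leq_trans ij) //.
  move: j jn ij; apply: lastE => [j jn ij|ij]; first by rewrite C'E // rC // ij.
  by rewrite C'n ltC.
have sR' i : (i < n.+1)%N -> side (R' i).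
  by move: i; apply: lastE => [i iN|]; [rewrite R'E // sR | rewrite R'n].
have sC' i : (i < n.+1)%N -> ~~ side (C' i).
  by move: i; apply: lastE => [i iN|]; [rewrite C'E // sC | rewrite C'n].
(* [b] tells whether the new ends are adjacent: [true] is the closed ladder excluded by [no_ladder],
   [false] the longer ladder. *)
have eRC' b i j : e x y = b -> (i < n.+1)%N -> (j < n.+1)%N -> e (R' i) (C' j) =
    [|| i.+1 == j, j.+1 == i | (i == j) && ((i == 0) || b && (i.+1 == n.+1))]%N.
  move=> xyb iN jN; move: i iN; apply: (lastE) => [i iN|]; move: j jN; apply: lastE => [j jN|].
  - by rewrite R'E // C'E // eRC //; rewrite eqSS (ltn_eqF iN) andbF orbF.
  - rewrite R'E // C'n; have [lt|ge] := leqP i d; first by rewrite Ry // far.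
    have -> : i = d.+1 by apply/eqP; rewrite eqn_leq ge -ltnS iN.
    by rewrite y1 eqxx.
  - rewrite R'n C'E // e_sym; have [lt|ge] := leqP j d.
      by rewrite Cx // orbCA (eq_sym n) far.
    have -> : j = d.+1 by apply/eqP; rewrite eqn_leq ge -ltnS jN.
    by rewrite x1; symmetry; apply/or3P; apply: Or32; apply/eqP.
  - by rewrite R'n C'n xyb !eqxx andbT (gtn_eqF (ltnSn _)).
have xy : e x y = false.
  apply/negP => xy; apply: (@no_ladder n.+1 R' C' r) => // i j iN jN.
  by rewrite (eRC' true).
exists R', C'; split=> [i j ijn|i iN|i j iN jN|i w iN|i w iN].
- by split; [apply: rR' | apply: rC'].
- by split; [apply: sR' | apply: sC'].
- by rewrite (eRC' false) // andFb orbF.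
- rewrite (R'E i) ?(R'E i.+1) //; last by rewrite -ltnS ltnW.
  move: iN; rewrite ltnS leq_eqVlt => /orP[/eqP[-> ]|iN]; first by rewrite C'n; apply: ay.
  by rewrite C'E //; apply: aR.
- rewrite (C'E i) ?(C'E i.+1) //; last by rewrite -ltnS ltnW.
  move: iN; rewrite ltnS leq_eqVlt => /orP[/eqP[-> ]|iN]; first by rewrite R'n; apply: ax.
  by rewrite R'E //; apply: aC.
Qed.

End DoublyLexical.

(** * The initial ideal of the toric ideal *)

Lemma sum_nat_exists_gt (I : finType) (P : pred I) (a b : I -> nat) i :
  (\sum_(j | P j) a j = \sum_(j | P j) b j)%N -> P i -> (b i < a i)%N ->
  exists2 j, P j & (a j < b j)%N.
Proof.
move=> E Pi lt; case: (boolP [exists j, P j && (a j < b j)%N]).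
  by case/existsP => j /andP[]; exists j.
rewrite negb_exists => /forallP no.
have le j : P j -> (b j <= a j)%N by move=> Pj; have := no j; rewrite Pj -leqNgt.
suff : (\sum_(j | P j) b j < \sum_(j | P j) a j)%N by rewrite E ltnn.
rewrite (bigD1 i) //= [X in (_ < X)%N](bigD1 i) //= -addSn leq_add //.
by apply: leq_sum => j /andP[/le].
Qed.

Section ToricInitialIdeal.

Variables (k : fieldType) (V : finType) (e : rel V) (X Y : {set V}).
Hypothesis e_irr : irreflexive e.
Hypothesis XY0 : X :&: Y = set0.
Local Notation N := #|edges e|.
Local Notation S := {mpoly k[N]}.
Implicit Types (m : 'X_{1..N}) (i j a b : 'I_N) (s t : {set 'I_N}).

Variables xe ye : 'I_N -> V.
Hypothesis xeX : forall i, xe i \in X.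
Hypothesis yeY : forall i, ye i \in Y.
Hypothesis xye : forall i, enum_val i = [set xe i; ye i].
Hypothesis exy : forall i, e (xe i) (ye i).
Hypothesis edge_index : forall x y, x \in X -> y \in Y -> e x y ->
  exists2 i, xe i = x & ye i = y.
Variable r : V -> nat.
Hypothesis r_inj : injective r.
Hypothesis gamma : forall u u' z z', (r u < r u')%N -> (r z < r z')%N ->
    e u z -> e u z' -> e u' z -> e u' z'.

Lemma XYdisj x : x \in X -> x \in Y -> False.
Proof. by move=> xX xY; have := in_set0 x; rewrite -XY0 inE xX xY. Qed.

Lemma edge_inj i j : xe i = xe j -> ye i = ye j -> i = j.
Proof. by move=> xij yij; apply: enum_val_inj; rewrite !xye xij yij. Qed.

Definition vdeg m : 'X_{1..#|V|} :=
  (\sum_i (U_(enum_rank (xe i)) + U_(enum_rank (ye i))) *+ m i)%MM.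

Lemma vdegD m m' : vdeg (m + m') = (vdeg m + vdeg m')%MM.
Proof.
rewrite /vdeg -big_split /=; apply: eq_bigr => i _.
by apply/mnmP => v; rewrite !(mnmDE, mulmnE) mulnDr.
Qed.

Lemma vdegU i : vdeg U_(i) = (U_(enum_rank (xe i)) + U_(enum_rank (ye i)))%MM.
Proof.
rewrite /vdeg (bigD1 i) //= mnm1E eqxx mulm1n big1 ?addm0 // => j.
by rewrite mnm1E eq_sym => /negbTE ->; rewrite mulm0n.
Qed.

Lemma vdegE m v : vdeg m (enum_rank v) =
  (\sum_i ((xe i == v) + (ye i == v)) * m i)%N.
Proof.
rewrite mnm_sumE; apply: eq_bigr => i _.
by rewrite mulmnE mnmDE !mnm1E !(inj_eq enum_rank_inj).
Qed.

Lemma vdeg_row m m' x : vdeg m = vdeg m' -> x \in X ->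
  (\sum_(i | xe i == x) m i = \sum_(i | xe i == x) m' i)%N.
Proof.
move=> E xX; have H m0 : (\sum_(i | xe i == x) m0 i)%N = vdeg m0 (enum_rank x).
  rewrite vdegE big_mkcond; apply: eq_bigr => i _.
  have -> : (ye i == x) = false.
    by apply/eqP => yx; apply: (@XYdisj x) => //; rewrite -yx.
  by case: eqP; rewrite ?mul1n ?mul0n.
by rewrite !H E.
Qed.

Lemma vdeg_col m m' y : vdeg m = vdeg m' -> y \in Y ->
  (\sum_(i | ye i == y) m i = \sum_(i | ye i == y) m' i)%N.
Proof.
move=> E yY; have H m0 : (\sum_(i | ye i == y) m0 i)%N = vdeg m0 (enum_rank y).
  rewrite vdegE big_mkcond; apply: eq_bigr => i _.
  have -> : (xe i == y) = false.
    by apply/eqP => yx; apply: (@XYdisj y) => //; rewrite -yx.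
  by case: eqP; rewrite ?mul1n ?mul0n.
by rewrite !H E.
Qed.

Lemma toric_mapX m : toric_map e k 'X_[m] = 'X_[vdeg m].
Proof.
rewrite /toric_map comp_mpolyX /vdeg -mprodXnE; apply: eq_bigr => i _.
rewrite tnth_mktuple /edge_monomial xye mpolyXD; congr (_ ^+ _).
rewrite big_setU1 ?big_set1 // inE; apply/eqP => xy.
by have := exy i; rewrite xy e_irr.
Qed.

Lemma mcoeff_toric_map (p : S) d : (toric_map e k p)@_d =
  \sum_(m <- msupp p) p@_m * (vdeg m == d)%:R.
Proof.
rewrite /toric_map comp_mpolyEX raddf_sum; apply: eq_bigr => m _.
by rewrite /= mcoeffZ -/(toric_map e k 'X_[m]) toric_mapX mcoeffX.
Qed.

(** The image of [p] at this vertex degree sums the coefficients over a fibre in which only [m] can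
    contribute. *)
Lemma toric_ideal_coeff (p : S) m : toric_ideal e k p ->
  (forall m', p@_m' != 0 -> vdeg m' = vdeg m -> m' = m) -> p@_m = 0.
Proof.
move=> /eqP /(congr1 (mcoeff (vdeg m))); rewrite mcoeff_toric_map mcoeff0 => E U.
have [ms|] := boolP (m \in msupp p); last by rewrite -mcoeff_eq0 => /eqP.
move: E; rewrite (bigD1_seq m) //= eqxx mulr1 big_seq_cond big1 ?addr0 //.
move=> m' /andP[]; rewrite mcoeff_msupp => m's mm'.
case: eqP => [/(U _ m's) E|_]; last by rewrite mulr0.
by rewrite E eqxx in mm'.
Qed.

Lemma toric_ideal0 : toric_ideal e k 0.
Proof. by rewrite /toric_ideal /toric_map comp_mpoly0. Qed.

Lemma toric_idealD p q : toric_ideal e k p -> toric_ideal e k q ->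
  toric_ideal e k (p + q).
Proof.
move=> /eqP p0 /eqP q0; rewrite /toric_ideal /toric_map comp_mpolyD.
by rewrite -!/(toric_map e k _) p0 q0 addr0.
Qed.

Lemma toric_idealM p q : toric_ideal e k q -> toric_ideal e k (p * q).
Proof.
move=> /eqP q0; rewrite /toric_ideal /toric_map rmorphM /=.
by rewrite -!/(toric_map e k _) q0 mulr0.
Qed.

Lemma toric_ideal_const p : toric_ideal e k p -> p@_0%MM = 0.
Proof.
move=> pI; apply: toric_ideal_coeff => // m _ m0; apply/mnmP => i; rewrite mnm0E.
have := vdeg_row m0 (xeX i); rewrite [RHS]big1; last by move=> j _; rewrite mnm0E.
by move/eqP; rewrite sum_nat_eq0 => /forall_inP/(_ i)/(_ (eqxx _))/eqP.
Qed.

(** The edge [i] lies in the upper row, the one of smaller rank. The fourth edge of the rectangle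
    comes from [gamma]. *)
Definition crossing : rel 'I_N := fun i j =>
  [&& (r (xe i) < r (xe j))%N, (r (ye j) < r (ye i))%N & e (xe i) (ye j)].

Definition standard m := independent crossing (mnmsupp m).

(** Uncrossing a pair raises the sum of rank products, so subtracting from [B * B] lowers the
    weight. [B * B] bounds every product, hence nothing truncates. *)
Definition edge_weight i : nat :=
  let B := \max_v r v in (B * B - r (xe i) * r (ye i))%N.

Local Notation wt := (mweight edge_weight).

Lemma mweightU i : wt U_(i) = edge_weight i.
Proof.
rewrite /mweight (bigD1 i) //= mnm1E eqxx mul1n big1 ?addn0 // => j.
by rewrite mnm1E eq_sym => /negbTE ->.
Qed.

Lemma crossing_irr : irreflexive crossing.
Proof. by move=> i; rewrite /crossing ltnn. Qed.

Lemma crossing_swap i j : crossing i j -> exists a b,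
  [/\ vdeg (U_(a) + U_(b)) = vdeg (U_(i) + U_(j)),
      (wt (U_(a) + U_(b)) < wt (U_(i) + U_(j)))%N & e (xe j) (ye i)].
Proof.
case/and3P=> rx ry exy'.
have e4 : e (xe j) (ye i) by apply: gamma rx ry exy' (exy i) (exy j).
have [a xa ya] := edge_index (xeX i) (yeY j) exy'.
have [b xb yb] := edge_index (xeX j) (yeY i) e4.
exists a, b; split=> //.
  rewrite !vdegD !vdegU xa ya xb yb; apply/mnmP => v; rewrite !mnmDE; lia.
rewrite !mweightD !mweightU /edge_weight xa ya xb yb.
have le v : (r v <= \max_v r v)%N by apply: leq_bigmax.
have := le (xe i); have := le (xe j); have := le (ye i); have := le (ye j).
move: (\max_v r v) rx ry; move: (r (xe i)) (r (xe j)) (r (ye i)) (r (ye j)).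
by move=> x x' y' y B xx' yy' *; nia.
Qed.

Lemma toric_ideal_reduction m : ~~ standard m -> exists m',
  [/\ mdeg m' = mdeg m, (wt m' < wt m)%N, vdeg m' = vdeg m &
      toric_ideal e k ('X_[m] - 'X_[m'])].
Proof.
case/forall_inPn => i; rewrite inE => mi /forall_inPn[j]; rewrite inE => mj /negPn cij.
have [a [b [vab wab _]]] := crossing_swap cij.
have ij : i != j by apply: contraTneq cij => ->; rewrite crossing_irr.
have le : (U_(i) + U_(j) <= m)%MM.
  apply/mnm_lepP => l; rewrite mnmDE !mnm1E.
  by case: eqP => [<-|_]; case: eqP => [E|_] //; move: ij; rewrite ?E ?eqxx //; move=> _;
     rewrite -?E.
have [m0 ->] : exists m0, m = (m0 + (U_(i) + U_(j)))%MM.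
  by exists (m - (U_(i) + U_(j)))%MM; rewrite submK.
exists (m0 + (U_(a) + U_(b)))%MM.
have vE : vdeg (m0 + (U_(a) + U_(b))) = vdeg (m0 + (U_(i) + U_(j))).
  by rewrite vdegD vab -vdegD.
split=> //.
- by rewrite !mdegD !mdeg1.
- by rewrite !(mweightD _ m0) ltn_add2l.
- rewrite /toric_ideal /toric_map comp_mpolyB -!/(toric_map e k _) !toric_mapX.
  by rewrite vE subrr.
Qed.

(* The two monomials are compared at the lexicographically first edge where
   they differ; the one with the smaller exponent there has a crossing. *)
Lemma standard_uniq m m' : standard m -> standard m' -> vdeg m = vdeg m' -> m = m'.
Proof.
have main m1 m2 i : standard m2 -> vdeg m1 = vdeg m2 -> (m2 i < m1 i)%N ->
    (forall j, m1 j != m2 j -> (r (xe i) <= r (xe j))%N) ->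
    (forall j, m1 j != m2 j -> xe j = xe i -> (r (ye i) <= r (ye j))%N) -> False.
  move=> /independentP st2 E lt minx miny.
  (* Equal row and column sums force an edge [j] in the row of [i] and an edge [l] in its column
     where [m2] is larger; minimality of [i] makes them cross. *)
  have [j /eqP xj ltj] := sum_nat_exists_gt (vdeg_row E (xeX i)) (eqxx _) lt.
  have [l /eqP yl ltl] := sum_nat_exists_gt (vdeg_col E (yeY i)) (eqxx _) lt.
  have nej : m1 j != m2 j by rewrite neq_ltn ltj.
  have nel : m1 l != m2 l by rewrite neq_ltn ltl.
  have ji : j != i by apply: contraTneq ltj => ->; rewrite -leqNgt ltnW.
  have li : l != i by apply: contraTneq ltl => ->; rewrite -leqNgt ltnW.
  have := st2 j l; rewrite !inE (leq_trans _ ltj) // (leq_trans _ ltl) //.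
  move=> /(_ isT isT) /negP; apply; apply/and3P; split.
  - rewrite xj ltn_neqAle minx // andbT; apply: contraNneq li => /r_inj E'.
    by apply/eqP/edge_inj.
  - rewrite yl ltn_neqAle miny // andbT; apply: contraNneq ji => /r_inj E'.
    by apply/eqP/edge_inj.
  - by rewrite xj yl.
move=> st st' E; apply/mnmP => i0; apply/eqP/negPn/negP => ne0.
pose i1 := [arg min_(i < i0 | m i != m' i) r (xe i)].
have [ne1 min1] : m i1 != m' i1 /\ forall j, m j != m' j -> (r (xe i1) <= r (xe j))%N.
  by rewrite /i1; case: arg_minnP.
pose P i := (m i != m' i) && (xe i == xe i1).
have P1 : P i1 by rewrite /P ne1 eqxx.
pose i := [arg min_(i < i1 | P i) r (ye i)].
have [/andP[ne /eqP xi] min2] : P i /\ forall j, P j -> (r (ye i) <= r (ye j))%N.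
  by rewrite /i; case: arg_minnP.
have minx j : m j != m' j -> (r (xe i) <= r (xe j))%N by rewrite xi; apply: min1.
have miny j : m j != m' j -> xe j = xe i -> (r (ye i) <= r (ye j))%N.
  by move=> nej xj; apply: min2; rewrite /P nej xj xi eqxx.
move: (ne); rewrite neq_ltn => /orP[] lt.
  apply: (main m' m i) => // j; rewrite eq_sym; [exact: minx | exact: miny].
exact: (main m m' i).
Qed.

(** Reductions keep the vertex degree and lower the weight; starting from [m'] they end in a
    standard monomial, which is [m] by uniqueness. *)
Lemma standard_min m m' : standard m -> vdeg m' = vdeg m -> m' != m ->
  (wt m < wt m')%N.
Proof.
move=> st; move: {2}(wt m').+1 (ltnSn (wt m')) => n.
elim: n m' => // n IH m' le E ne.
have [st'|nst] := boolP (standard m').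
  by rewrite (standard_uniq st st') ?eqxx in ne.
have [m2 [_ lt2 v2 _]] := toric_ideal_reduction nst.
have [<- //|ne2] := eqVneq m2 m.
by apply: ltn_trans (lt2); apply: IH; rewrite ?v2 //; apply: leq_trans lt2 _.
Qed.

Lemma toric_ideal_top (p : S) m : toric_ideal e k p -> standard m ->
  (forall m', p@_m' != 0 -> (wt m' <= wt m)%N) -> p@_m = 0.
Proof.
move=> pI st le; apply: toric_ideal_coeff => // m' /le le' E.
by apply/eqP; apply: contraTT le' => /(standard_min st E); rewrite -ltnNge.
Qed.

Definition upper_rows : {set V} := [set x | [exists i, exists j, crossing i j && (xe i == x)]].

Lemma card_upper_rows i j : crossing i j ->
  (#|upper_rows| < #|[set x in X | degree e x != 1]|)%N.
Proof.
have deg2 x y y' : e x y -> e x y' -> y != y' -> degree e x != 1%N.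
  move=> xy xy' yy'; rewrite neq_ltn orbC /degree (@leq_trans #|[set y; y']|) //.
    by rewrite cards2 yy'.
  by apply/subset_leq_card/subsetP => z /set2P[] ->; rewrite inE.
have neY a b : crossing a b -> ye a != ye b.
  by case/and3P => _ + _; apply: contraTneq => ->; rewrite ltnn.
move=> cij; pose P a := [exists b, crossing a b].
have Pi : P i by apply/existsP; exists j.
pose a := [arg max_(a > i | P a) r (xe a)].
have [/existsP[b cab] amax] : P a /\ forall a', P a' -> (r (xe a') <= r (xe a))%N.
  by rewrite /a; case: arg_maxnP.
apply/proper_card/properP; split.
  apply/subsetP => x; rewrite !inE => /existsP[a' /existsP[b' /andP[c' /eqP <-]]].
  rewrite xeX; case/and3P: (c') => _ _ e'; apply: deg2 (exy a') e' _; exact: neY.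
(* [xe b] ranks beyond the last upper row, so it is not upper, yet it has degree at least 2. *)
exists (xe b).
  rewrite inE xeX; have [_ [_ [_ _ e']]] := crossing_swap cab.
  by apply: deg2 e' (exy b) _; apply: neY.
rewrite inE; apply/negP => /existsP[a' /existsP[b' /andP[c' /eqP xa']]].
have := amax a'; rewrite xa' leqNgt; case/and3P: cab => -> _ _.
by move=> H; apply/notF/H/existsP; exists b'.
Qed.

(** A repeated variable or a support without crossings gives a cone. Otherwise the faces [U :\: s]
    have [q] elements, more than there are upper rows. *)
Lemma toric_multigraded_exact p q (mu : 'X_{1..N}) (f : {set 'I_N} -> k) :
  (0 < p)%N -> (#|[set x in X | degree e x != 1%N]| <= q)%N ->
  mdeg mu = (p + q)%N ->
  (forall t, t \subset mnmsupp mu -> standard (mu - msquarefree t) ->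
     sdiff (mnmsupp mu) f t = 0) ->
  exists g, forall s, s \subset mnmsupp mu -> #|s| = p ->
     standard (mu - msquarefree s) -> f s = sdiff (mnmsupp mu) g s.
Proof.
move=> p0 Dq dmu Hf; set U := mnmsupp mu in Hf *.
have cone v : v \in U ->
    (forall s, s \subset U -> v \in s -> standard (mu - msquarefree s) ->
       standard (mu - msquarefree (s :\ v))) ->
    exists g, forall s, s \subset U -> #|s| = p ->
      standard (mu - msquarefree s) -> f s = sdiff U g s.
  move=> vU H; exists (fun s => if v \in s then ksign k v (s :\ v) * f (s :\ v) else 0).
  move=> s sU _ st; rewrite sdiff_cone // => vs; apply: Hf; last exact: H.
  exact: subset_trans (subD1set _ _) sU.
(* If [v] has exponent at least 2, removing it from [s] leaves the support of [mu - msquarefree s]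
   unchanged. *)
case: (pickP (fun v => 1 < mu v)%N) => [v v2|sqf].
  apply: (cone v) => [|s sU vs]; first by rewrite inE ltnW.
  congr (independent _ _); apply/setP => i; rewrite !inE !mnmBE !mnmE !inE.
  case: (i =P v) => //= ->; rewrite vs subn0.
  by rewrite (ltnW v2) subn_gt0 v2.
have le1 i : (mu i <= 1)%N by rewrite leqNgt sqf.
have stdE t : t \subset U -> standard (mu - msquarefree t) = independent crossing (U :\: t).
  move=> tU; congr (independent _ _); apply/setP => i; rewrite !inE mnmBE mnmE.
  by have := le1 i; case: (mu i) => [|[|]] //; case: (i \in t).
have cardU : #|U| = (p + q)%N.
  rewrite -dmu mdegE -sum1_card big_mkcond; apply: eq_bigr => i _; rewrite inE.
  by have := le1 i; case: (mu i) => [|[|]].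
have [indU|] := boolP (independent crossing U).
  (* The apex exists because [0 < p], even when [q = 0]. *)
  have [v vU] : exists v, v \in U by apply/set0Pn; rewrite -card_gt0 cardU addn_gt0 p0.
  apply: (cone v) => // s sU vs _.
  rewrite stdE; last exact: subset_trans (subD1set _ _) sU.
  apply/independentP => i j /setDP[iU _] /setDP[jU _].
  by move/independentP: indU; apply.
case/forall_inPn => i iU /forall_inPn[j jU /negPn cij].
(* Positions are column ranks: within a row, an edge with larger column crosses, as upper edge,
   everything that one with smaller column does. *)
have [|||t tU it|g Hg] := @independent_acyclic N k V crossing xe (r \o ye) _ _ U upper_rows f.
- exact: crossing_irr.
- move=> a a' b xa /= ya /and3P[c1 c2 c3]; apply/and3P; rewrite -xa; split=> //.
  exact: leq_trans ya.
- move=> a b _ _ cab; rewrite inE; apply/existsP; exists a; apply/existsP; exists b.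
  by rewrite cab eqxx.
- by apply: Hf; rewrite ?stdE.
exists g => s sU sp; rewrite stdE // => is_; apply: Hg => //.
rewrite cardsD (setIidPr sU) cardU sp addKn.
exact: leq_trans (card_upper_rows cij) Dq.
Qed.

Lemma toric_koszul_vanishes p q z : (0 < p)%N ->
  (#|[set x in X | degree e x != 1%N]| <= q)%N ->
  bihomogeneous p q z -> (forall t, toric_ideal e k (kbd z t)) ->
  exists y, forall s, toric_ideal e k (z s - kbd y s).
Proof.
move=> p0 Dq hz zc.
have [|||||mu dmu f|y [_ _ Hy]] := @koszul_quotient_exact N k edge_weight
  (toric_ideal e k) standard _ _ _ _ _ p q _ z hz zc.
- exact: toric_ideal0.
- exact: toric_idealD.
- exact: toric_idealM.
- exact: toric_ideal_top.
- by move=> m /toric_ideal_reduction[m' [? ? _ ?]]; exists m'.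
- exact: toric_multigraded_exact dmu.
- by exists y.
Qed.

End ToricInitialIdeal.

(** * The regularity bound *)

Lemma toric_shift_bound (k : fieldType) (V : finType) (e : rel V)
    (X Y : {set V}) (F : free_complex #|edges e| k) :
  ssrbool.symmetric e -> irreflexive e -> chordal_bipartite e -> bipartition e X Y ->
  graded_minimal_free_resolution F (toric_ideal e k) ->
  forall i (a : 'I_(frank F i)),
    fshift a - i%:Z <= #|[set x in X | degree e x != 1%N]|.
Proof.
move=> e_sym e_irr [_ chordal] [XYT XY0 hbip] hF i a.
have disj x : x \in X -> x \in Y -> False.
  by move=> xX xY; have := in_set0 x; rewrite -XY0 inE xX xY.
have side_e u v : e u v -> (u \in X) != (v \in X).
  move=> /hbip; case/orP => /andP[].
    by move=> -> vY; case: (boolP (v \in X)) => // /disj/(_ vY).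
  by move=> uY ->; case: (boolP (u \in X)) => // /disj/(_ uY).
have [r r_inj gamma] := gamma_free_rank e_sym e_irr side_e chordal.
have [xy Hxy] : exists xy : 'I_#|edges e| -> V * V, forall l,
    [/\ (xy l).1 \in X, (xy l).2 \in Y, e (xy l).1 (xy l).2 &
        enum_val l = [set (xy l).1; (xy l).2]].
  apply: (@fin_all_exists _ _ (fun l (p : V * V) => [/\ p.1 \in X, p.2 \in Y,
    e p.1 p.2 & enum_val l = [set p.1; p.2]])) => l.
  have := enum_valP l; rewrite inE => /existsP[u /existsP[v /andP[uv /eqP ->]]].
  case/orP: (hbip _ _ uv) => /andP[uX vX]; first by exists (u, v).
  by exists (v, u); rewrite setUC e_sym.
pose xe l := (xy l).1; pose ye l := (xy l).2.
have edge_index x y : x \in X -> y \in Y -> e x y -> exists2 l, xe l = x & ye l = y.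
  move=> xX yY exy.
  have xyE : [set x; y] \in edges e.
    by rewrite inE; apply/existsP; exists x; apply/existsP; exists y; rewrite exy eqxx.
  pose l := enum_rank_in xyE [set x; y].
  have [xX' yY' _] := Hxy l; rewrite enum_rankK_in // => lE.
  exists l.
    have : xe l \in [set x; y] by rewrite lE set21.
    by case/set2P => // xy'; case: (disj _ xX'); rewrite -/(xe l) xy'.
  have : ye l \in [set x; y] by rewrite lE set22.
  by case/set2P => // yx'; case: (disj x) => //; rewrite -yx'.
have xeX l : xe l \in X by case: (Hxy l).
have yeY l : ye l \in Y by case: (Hxy l).
have exy l : e (xe l) (ye l) by case: (Hxy l).
have xye l : enum_val l = [set xe l; ye l] by case: (Hxy l).
rewrite leNgt; apply/negP => lt.
(* In Koszul degree [i.+1] the polynomial degree is [q], so a shift with [fshift a - i] above the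
   bound makes [q] at least the bound. *)
have [q aq] : exists q, fshift a = (i.+1 + q)%N.
  case E : (fshift a - i.+1%:Z) => [q|q]; first by exists q; clear -E; lia.
  by exfalso; clear -E lt; lia.
apply: (koszul_vanishing_betti hF _ aq).
  by move=> p; apply: (toric_ideal_const e_irr XY0 xeX yeY xye exy).
move=> z hz zc.
apply: (toric_koszul_vanishes e_irr XY0 xeX yeY xye exy edge_index r_inj gamma _ _ hz zc) => //.
by clear -aq lt; lia.
Qed.

Lemma int_bounded_max (P : int -> Prop) (b : int) :
  (forall v, P v -> v <= b) -> (exists v, P v) ->
  exists2 v, P v & forall v', P v' -> v' <= v.
Proof.
move=> Pb [v Pv].
have [n le] : exists n : nat, b - v <= n by exists `|b - v|%N; lia.
elim: n v Pv le => [|n IH] v Pv le.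
  by exists v => // v' /Pb; lia.
case: (classic (exists2 v', P v' & v < v')) => [[v' Pv' lt]|no].
  by apply: (IH v' Pv'); lia.
exists v => // v' Pv'; rewrite leNgt; apply/negP => lt; apply: no; by exists v'.
Qed.

(** A [free_complex] may be infinite, so the existence of the maximum is itself drawn from the
    bound; [None] is the case without nonzero Betti numbers. *)
Lemma regularity_le N (k : fieldType) (F : free_complex N k) (b : int) :
  (forall i (a : 'I_(frank F i)), fshift a - i%:Z <= b) ->
  exists2 rho, is_regularity F rho & ext_le rho b.
Proof.
move=> bound.
have le i j : betti F i j <> 0%N -> j - i%:Z <= b.
  move=> /eqP; rewrite cards_eq0 => /set0Pn[a]; rewrite inE => /eqP <-; exact: bound.
case: (classic (exists v, exists i j, betti F i j <> 0%N /\ v = j - i%:Z)) => [ex|no].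
  have [v [i [j [nz ->]]] vmax] := int_bounded_max
    (P := fun v => exists i j, betti F i j <> 0%N /\ v = j - i%:Z) (b := b)
    ltac:(by move=> v [i [j [/le H ->]]]) ex.
  exists (Some (j - i%:Z)); last exact: le.
  split; first by exists i, j.
  by move=> i' j' nz'; apply: vmax; exists i', j'.
exists None => // i j; case: (eqVneq (betti F i j) 0%N) => // /eqP nz.
by case: no; exists (j - i%:Z), i, j.
Qed.

Local Close Scope ring_scope.

Theorem theorem1p2
  (k : fieldType) (V : finType) (e : rel V)
  (e_sym : ssrbool.symmetric e) (e_irr : irreflexive e)
  (hG : chordal_bipartite e)
  (X Y : {set V}) (hXY : bipartition e X Y)
  (n m r s : nat)
  (hn : n = #|X|) (hm : m = #|Y|)
  (hr : r = #|[set x in X | degree e x == 1]|)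
  (hs : s = #|[set y in Y | degree e y == 1]|)
  (F : free_complex #|edges e| k)
  (hF : graded_minimal_free_resolution F (toric_ideal e k)) :
  exists2 rho : option int,
    is_regularity F rho & ext_le rho (Posz (minn (n - r) (m - s))).
Proof.
(* Both terms of the minimum come from one estimate, applied with the sides exchanged. *)
have hYX : bipartition e Y X.
  have [h1 h2 h3] := hXY; split; rewrite 1?setUC 1?setIC // => u v /h3.
  by rewrite orbC.
have cardD (A : {set V}) : #|[set x in A | degree e x != 1%N]| =
    (#|A| - #|[set x in A | degree e x == 1%N]|)%N.
  rewrite -[in RHS](cardsID [set x | degree e x == 1%N] A).
  have -> : A :&: [set x | degree e x == 1%N] = [set x in A | degree e x == 1%N].
    by apply/setP => x; rewrite !inE.
  by rewrite addKn; apply: eq_card => x; rewrite !inE andbC.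
apply: regularity_le => i a.
have := toric_shift_bound e_sym e_irr hG hXY hF a.
have := toric_shift_bound e_sym e_irr hG hYX hF a.
rewrite !cardD -hn -hm -hr -hs; lia.
Qed.
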